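(* Let $\beta$ be a Salem number with minimal polynomial $f$, let $V_\beta$ be the two-sided beta-shift space, and let $\alpha=\alpha_{R_1/(f)}$ be the associated automorphism of $X=X_{R_1/(f)}$. For every $\tilde\sigma$-invariant probability measure $\tilde\mu$ on $\tilde Y_\beta$, the entropy (with respect to $\alpha$) of the push-forward $\tilde\xi_*(\tilde\mu)$ on $X$ is equal to the entropy of $\tilde\mu$ (with respect to $\tilde\sigma$).
   Context: A Salem number is an algebraic unit $\beta>1$ whose other conjugates all have absolute value $\le1$, with at least one conjugate of absolute value $1$. Let $f=f_0+\dots+f_mu^m\in R_1=\mathbb{Z}[u^{\pm1}]$ be its minimal polynomial ($f_m=1$). Let $\Omega_f\subset\mathbb{C}$ be the set of roots of $f$, and $\Omega_f^-$, $\Omega_f^{(0)}$, $\Omega_f^+$ the sets of roots of absolute value $<1$, $=1$, $>1$, respectively. $\mathbb{T}=\mathbb{R}/\mathbb{Z}$, $X=X_{R_1/(f)}=\{x\in\mathbb{T}^{\mathbb{Z}}:\sum_{j=0}^m f_jx_{k+j}=0 \text{ for every } k\in\mathbb{Z}\}$, and $\alpha=\alpha_{R_1/(f)}$ is the restriction to $X$ of the shift $\tau(x)_n=x_{n+1}$. Beta-shift: let $T_\beta x=\beta x \pmod 1$, and for $x\in[0,1)$ let $e_\beta(x)=(e_\beta(x)_n)_{n\ge1}$ with $e_\beta(x)_n=\beta T_\beta^{n-1}x-T_\beta^nx$. Let $V_\beta^+$ be the closure of $\{e_\beta(x):x\in[0,1)\}$ (product topology), and $V_\beta=\{v\in\ell^\infty(\mathbb{Z},\mathbb{Z}):(v_{n+1},v_{n+2},\dots)\in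 V_\beta^+\text{ for every }n\in\mathbb{Z}\}$. $\ell^\infty(\mathbb{Z},\mathbb{R})$ is the space of bounded real sequences, with the topology of coordinatewise convergence; $\ell^\infty(\mathbb{Z},\mathbb{Z})$ is the subgroup of integer-valued sequences. The shift is $(\bar\sigma w)_n=w_{n+1}$, and $f(\bar\sigma)=\sum_{j=0}^m f_j\bar\sigma^j$. Put $W_f^{(0)}=\{w\in\ell^\infty(\mathbb{Z},\mathbb{R}): f(\bar\sigma)w=0\}$, a finite-dimensional real vector space. Let $\rho$ be coordinatewise reduction mod $1$ of real sequences, and $X^{(0)}=\rho(W_f^{(0)})\subset X$ ($\rho$ is injective on $W_f^{(0)}$). Write $\frac1{f(u)}=\frac1{f_m}\sum_{\omega\in\Omega_f}\frac{b_\omega}{u-\omega}$ with $b_\omega\in\mathbb{C}$ and define $w^{\Delta_+},w^{\Delta_-}\in\ell^\infty(\mathbb{Z},\mathbb{R})$ by $w^{\Delta_+}_n=\frac1{f_m}\sum_{\omega\in\Omega_f^-}b_\omega\omega^{n-1}$ if $n\ge1$, $w^{\Delta_+}_n=-\frac1{f_m}\sum_{\omega\in\Omega_f^{(0)}\cup\Omega_f^+}b_\omega\omega^{n-1}$ if $n\le0$; $w^{\Delta_-}_n=\frac1{f_m}\sum_{\omega\in\Omega_f^-\cup\Omega_f^{(0)}}b_\omega\omega^{n-1}$ if $n\ge1$, $w^{\Delta_-}_n=-\frac1{f_m}\sum_{\omega\in\Omega_f^+}b_\omega\omega^{n-1}$ if $n\le0$. For $v\in\ell^\infty(\mathbb{Z},\mathbb{Z})$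 put $\bar\xi^*(v)=\sum_{n\ge0}v_n\bar\sigma^{-n}w^{\Delta_-}+\sum_{n<0}v_n\bar\sigma^{-n}w^{\Delta_+}$ (coordinatewise convergent; a real sequence of at most linear growth, to which $\bar\sigma$ is extended by the same formula). For $n\in\mathbb{Z}$ put $\mathsf{d}(n,v)=\bar\sigma^n\bar\xi^*(v)-\bar\xi^*(\bar\sigma^nv)\in W_f^{(0)}$. $\tilde Y=\ell^\infty(\mathbb{Z},\mathbb{Z})\times W_f^{(0)}$ (identified with $\ell^\infty(\mathbb{Z},\mathbb{Z})\times X^{(0)}$ via $\rho|_{W_f^{(0)}}$); $\tilde\sigma(v,w)=(\bar\sigma v,\bar\sigma w+\mathsf{d}(1,v))$ is a homeomorphism of $\tilde Y$; and $\tilde\xi:\tilde Y\to X$ is the map $\tilde\xi(v,w)=\rho(\bar\xi^*(v)+w)$, which satisfies $\tilde\xi\circ\tilde\sigma=\alpha\circ\tilde\xi$. Finally $\tilde Y_\beta=V_\beta\times W_f^{(0)}\cong V_\beta\times X^{(0)}$, a $\tilde\sigma$-invariant subset of $\tilde Y$. *)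

(* Defs.v *)
From HB Require Import structures.
From mathcomp Require Import all_boot all_order all_algebra ring_quotient.
From mathcomp Require Import complex.
From mathcomp Require Import all_classical all_reals all_analysis.

Set Implicit Arguments.
Unset Strict Implicit.
Unset Printing Implicit Defensive.

Import Order.TTheory GRing.Theory Num.Theory.
Import numFieldNormedType.Exports.

Local Open Scope classical_set_scope.
Local Open Scope ring_scope.

Section Entropy.
Context {d : measure_display} {T : measurableType d} {R : realType}.
Variables (mu : set T -> \bar R) (phi : T -> T).

Definition invariant_measure :=
  forall A, measurable A -> pushforward mu phi A = mu A.

Definition measurable_partition (k : nat) (P : 'I_k -> set T) :=
  partition setT P setT /\ forall i, measurable (P i).

Section Partition.
Variables (k : nat) (P : 'I_k -> set T).

(** The cell of [P \/ phi^-1 P \/ ... \/ phi^-(n-1) P] with itinerary [s]. *)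
Definition join_cell (n : nat) (s : {ffun 'I_n -> 'I_k}) : set T :=
  \bigcap_(i in [set: 'I_n]) (iter i phi @^-1` P (s i)).

(** [ln 0 = 0], so that empty cells contribute [0]. *)
Definition join_entropy (n : nat) : R :=
  \sum_(s : {ffun 'I_n -> 'I_k})
    - (fine (mu (join_cell s)) * ln (fine (mu (join_cell s)))).

Definition partition_entropy : R := limn (fun n => join_entropy n / n%:R).

End Partition.

Definition entropy : \bar R :=
  ereal_sup [set h | exists k (P : 'I_k -> set T),
    measurable_partition P /\ h = (partition_entropy P)%:E].

End Entropy.

Definition borel (T : ptopologicalType) : Type :=
  g_sigma_algebraType (@open T).
HB.instance Definition _ (T : ptopologicalType) :=
  Measurable.on (borel T).

Section Salem.
Context {R : realType}.
Implicit Types (beta : R) (f : {poly int}).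

Definition algebraic_unit beta :=
  integralOver (intr : int -> R) beta /\ integralOver (intr : int -> R) beta^-1.

(** For an algebraic integer the monic minimal polynomial over the rationals has
    integer coefficients. *)
Definition is_minimal_polynomial beta f :=
  [/\ f \is monic, root (map_poly intr f) beta &
      forall q : {poly rat}, q != 0 -> root (map_poly ratr q) beta ->
        (size f <= size q)%N].

Definition Omega f : set R[i] := [set z | root (map_poly intr f) z].
Definition Omega_minus f : set R[i] := [set z | Omega f z /\ `|z| < 1].
Definition Omega_zero f : set R[i] := [set z | Omega f z /\ `|z| = 1].
Definition Omega_plus f : set R[i] := [set z | Omega f z /\ 1 < `|z|].

Definition salem_number beta f :=
  [/\ algebraic_unit beta, 1 < beta, is_minimal_polynomial beta f,
      forall z, Omega f z -> z != beta%:C%C -> `|z| <= 1 &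
      exists z, Omega_zero f z].

End Salem.

Section Sequences.

Definition zshift {V : Type} (n : int) (w : int -> V) : int -> V :=
  fun k => w (k + n).

(** [f(sigma) w = \sum_j f_j sigma^j w], for sequences in any abelian group. *)
Definition poly_shift {V : zmodType} (f : {poly int}) (w : int -> V) : int -> V :=
  fun k => \sum_(j < size f) (zshift j%:Z w k) *~ f`_j.

Context {R : realType}.

Definition zseq : Type := {ptws int -> R}.
HB.instance Definition _ := Topological.copy zseq {ptws int -> R}.
HB.instance Definition _ := Pointed.copy zseq (int -> R).

Definition linfR : set zseq := [set w | bounded_fun (w : int -> R)].
Definition linfZ : set zseq :=
  [set v | linfR v /\ forall n, v n \is a Num.int].

Definition W0 (f : {poly int}) : set zseq :=
  [set w | linfR w /\ forall n, poly_shift f w n = 0].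

End Sequences.
Arguments zseq : clear implicits.

Section BetaShift.
Context {R : realType}.
Variable beta : R.

Definition T_beta (x : R) : R := beta * x - (Num.floor (beta * x))%:~R.

(** Indexed from [0]: [e_beta x n] is the digit number [n + 1]. *)
Definition e_beta (x : R) : {ptws nat -> R} :=
  fun n => beta * iter n T_beta x - iter n.+1 T_beta x.

Definition V_beta_plus : set {ptws nat -> R} :=
  closure (e_beta @` [set x | 0 <= x < 1]).

Definition V_beta : set (zseq R) :=
  [set v | linfZ v /\ forall n : int,
     V_beta_plus (fun k : nat => v (n + 1 + k%:Z))].

Lemma V_beta0 : V_beta (fun=> 0).
Proof.
have T0 n : iter n T_beta 0 = 0.
  by elim: n => // n IHn; rewrite iterS IHn /T_beta mulr0 floor0 subr0.
split; first split.
- apply/ex_bound; first exact: (@globally_properfilter _ _ (0 : int)).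
  by exists 0 => x _ /=; rewrite normr0.
- by move=> n /=; exact: rpred0.
- move=> n; apply: subset_closure; exists 0; first by rewrite /= lexx ltr01.
  by apply/funext => k; rewrite /e_beta !T0 mulr0 subr0.
Qed.

End BetaShift.

Section Homoclinic.
Context {R : realType}.
Variables (f : {poly int}) (b : R[i] -> R[i]).

(** [1 / f(u) = f_m^-1 * \sum_w b_w / (u - w)]; this determines [b] on
    [Omega f]. *)
Definition partial_fractions :=
  forall u : R[i], ~ Omega f u ->
    ((map_poly intr f).[u])^-1 =
    (lead_coef f)%:~R^-1 * \sum_(z \in Omega f) b z / (u - z).

(** The sums are real because [Omega f] is stable under conjugation. *)
Definition delta_sum (A : set R[i]) (n : int) : R :=
  complex.Re ((lead_coef f)%:~R^-1 * \sum_(z \in A) b z * z ^ (n - 1)).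

Definition w_delta_plus : zseq R := fun n =>
  if 1 <= n then delta_sum (Omega_minus f) n
  else - delta_sum (Omega_zero f `|` Omega_plus f) n.

Definition w_delta_minus : zseq R := fun n =>
  if 1 <= n then delta_sum (Omega_minus f `|` Omega_zero f) n
  else - delta_sum (Omega_plus f) n.

Definition xi_star (v : zseq R) : zseq R := fun k =>
  limn (fun N => \sum_(0 <= n < N)
    v n%:Z * zshift (- n%:Z) w_delta_minus k) +
  limn (fun N => \sum_(1 <= n < N)
    v (- n%:Z) * zshift n%:Z w_delta_plus k).

Definition cocycle (n : int) (v : zseq R) : zseq R := fun k =>
  zshift n (xi_star v) k - xi_star (zshift n v) k.

Definition sigma_tilde (y : zseq R * zseq R) : zseq R * zseq R :=
  (zshift 1 y.1, fun k => zshift 1 y.2 k + cocycle 1 y.1 k).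

End Homoclinic.

(** [Num.int_num_subdef] is the predicate underlying [_ \is a Num.int]. *)
Definition R_mod_Z (R : realType) :=
  Quotient.quot (GRing.ZmodClosed.clone R Num.int_num_subdef _).
HB.instance Definition _ (R : realType) := GRing.Zmodule.on (R_mod_Z R).
HB.instance Definition _ (R : realType) := Quotient.on (R_mod_Z R).

Definition torus (R : realType) : Type := quotient_topology (R_mod_Z R).
HB.instance Definition _ (R : realType) := PointedTopological.on (torus R).
HB.instance Definition _ (R : realType) := Quotient.on (torus R).
HB.instance Definition _ (R : realType) := GRing.Zmodule.copy (torus R) (R_mod_Z R).

Section AlgebraicSystem.
Context {R : realType}.
Variable f : {poly int}.

Definition rho (w : zseq R) : {ptws int -> torus R} :=
  fun n => (\pi_(torus R) (w n))%qT.

Definition X_set : set {ptws int -> torus R} :=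
  [set x | forall k, poly_shift f x k = 0].

Definition X : Type := set_type X_set.
HB.instance Definition _ := Topological.on X.
HB.instance Definition _ := SubType.on X.

Lemma X_set0 : X_set (fun=> 0).
Proof.
by move=> k; rewrite /poly_shift big1 // => j _; rewrite /zshift mul0rz.
Qed.

Definition X0 : X := exist (fun x => x \in X_set) _ (mem_set X_set0).
HB.instance Definition _ := isPointed.Build X X0.

Lemma alpha_subproof (x : X) : X_set (zshift 1 (val x)).
Proof.
move=> k; have := set_mem (valP x) (k + 1); rewrite /poly_shift /zshift => xk.
by rewrite -[RHS]xk; apply: eq_bigr => j _; rewrite addrAC.
Qed.

Definition alpha (x : X) : X := exist (fun x => x \in X_set) _ (mem_set (alpha_subproof x)).

End AlgebraicSystem.

Section ExtendedBetaShift.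
Context {R : realType}.
Variables (beta : R) (f : {poly int}) (b : R[i] -> R[i]).

Definition Ytilde_beta_set : set (zseq R * zseq R) := V_beta beta `*` W0 f.

Definition Ytilde_beta : Type := set_type Ytilde_beta_set.
HB.instance Definition _ := Topological.on Ytilde_beta.
HB.instance Definition _ := SubType.on Ytilde_beta.

Lemma Ytilde_beta_set0 : Ytilde_beta_set (fun=> 0, fun=> 0).
Proof.
split=> /=; first exact: V_beta0.
split; first by case: (V_beta0 beta) => -[].
by move=> k; rewrite /poly_shift big1 // => j _; rewrite /zshift mul0rz.
Qed.

Definition Ytilde_beta0 : Ytilde_beta := exist (fun y => y \in Ytilde_beta_set) _ (mem_set Ytilde_beta_set0).
HB.instance Definition _ := isPointed.Build Ytilde_beta Ytilde_beta0.

(** Restriction of [sigma_tilde]; the default value of [insubd] is never used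
    when [salem_number beta f] and [partial_fractions f b] hold, as
    [Ytilde_beta_set] is then invariant. *)
Definition sigma_tilde_beta (y : Ytilde_beta) : Ytilde_beta :=
  insubd y (sigma_tilde f b (val y)).

(** Likewise the default value is never used here: then
    [f(sigma) (xi_star v) = v] is integer-valued. *)
Definition xi_tilde (y : Ytilde_beta) : X f :=
  insubd (X0 f) (rho (fun k => xi_star f b (val y).1 k + (val y).2 k)).

End ExtendedBetaShift.

(* Main.v *)
Require Import Defs.
From HB Require Import structures.
From mathcomp Require Import all_boot all_order all_algebra ring_quotient.
From mathcomp Require Import complex.
From mathcomp Require Import all_classical all_reals all_analysis.
From mathcomp Require Import ring lra zify.

(** The push-forward is a factor of the extended beta-shift, because [xi_tilde]
    intertwines [sigma_tilde_beta] and [alpha], so its entropy is at most that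
    of [mu]. For the converse one shows that the fibres of [xi_tilde] have no
    entropy.

    A point [y = (v, w)] has the real lift [xi_star v + w], on which
    [sigma_tilde] acts as the shift and which satisfies [f(sigma) (xi_star v +
    w) = v]. Its fractional parts are functions of [xi_tilde y]; let [z] be its
    integer parts. Then [v = c + f(sigma) z], where the carry [c] is bounded and
    a function of [xi_tilde y]. Suppose two points have the same carries on the
    window [0, n) and the same [z] at both ends of it. Multiplying by powers of
    [beta^-1] and summing, the difference of the digit words becomes zero
    because [f(beta) = 0]: the words have the same value in base [beta], and as
    greedy expansions are determined by their values they are equal
    ([V_beta_window_eq], [carry_window_eq]). The fibre coordinate [w] moves by
    the shift of [W0 f], whose powers are uniformly bounded, and by a
    translation that depends on the digits only, so fibre coordinates which are
    close at time [0] remain close ([carry_window_close]).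

    The drift in the fibre is at most linear in time, hence [z] is of size
    [O(n)] at the ends of the window ([lift_growth]) and the data to be added to
    the carry word take only polynomially many values. By Lusin's theorem
    ([lusin_label]) a finite valued function is determined, up to rare errors,
    by a sufficiently good approximation of its argument. So the itinerary of
    such a function over [0, n) can be coded by the carry word with [o(n)] extra
    information ([coding_bound], [entropy_over_carry]), and no partition has
    entropy larger than that of the partition of [X f] according to the carry at
    time [0]. *)

Set Implicit Arguments.
Unset Strict Implicit.
Unset Printing Implicit Defensive.

Import Order.TTheory GRing.Theory Num.Theory.
Import numFieldNormedType.Exports.

Local Open Scope classical_set_scope.
Local Open Scope ring_scope.

(** * Finite valued functions and their entropy *)

Section Labels.
Context {d : measure_display} {T : measurableType d} {R : realType}.
Implicit Types (I J : finType).

Definition measurable_label I (g : T -> I) :=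
  forall i, measurable (g @^-1` [set i]).

(** Partitions enter as functions with values in a finite type, so that joins
    are pairings and itineraries, and coarser partitions are compositions. *)
Definition label_prob (mu : set T -> \bar R) I (g : T -> I) (i : I) : R :=
  fine (mu (g @^-1` [set i])).

Definition label_entropy (mu : set T -> \bar R) I (g : T -> I) : R :=
  \sum_i - (label_prob mu g i * ln (label_prob mu g i)).

Definition itinerary (phi : T -> T) I (g : T -> I) n (y : T) :
    {ffun 'I_n -> I} :=
  [ffun t : 'I_n => g (iter t phi y)].

Lemma measurable_label_set I (g : T -> I) (A : set I) :
  measurable_label g -> measurable (g @^-1` A).
Proof.
move=> mg.
have -> : g @^-1` A = \bigcup_(i in A) (g @^-1` [set i]).
  by apply/seteqP; split=> [y Ay|y [i Ai /= ->]//]; exists (g y).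
by apply: fin_bigcup_measurable => //; exact: finite_finset.
Qed.

Lemma measurable_label_comp I J (g : T -> I) (h : I -> J) :
  measurable_label g -> measurable_label (h \o g).
Proof.
by move=> mg j; rewrite comp_preimage; exact: measurable_label_set.
Qed.

Lemma measurable_label_pair I J (g : T -> I) (h : T -> J) :
  measurable_label g -> measurable_label h ->
  measurable_label (fun y => (g y, h y)).
Proof.
move=> mg mh [i j].
have -> : (fun y => (g y, h y)) @^-1` [set (i, j)] =
    g @^-1` [set i] `&` h @^-1` [set j].
  by apply/seteqP; split=> y /=; [case=> -> ->|case=> -> ->].
exact: measurableI.
Qed.

Lemma measurable_label_ffun (E : finType) I (g : E -> T -> I) :
  (forall e, measurable_label (g e)) ->
  measurable_label (fun y => [ffun e => g e y]).
Proof.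
move=> mg s.
have -> : (fun y => [ffun e => g e y]) @^-1` [set s] =
    \bigcap_(e in [set: E]) (g e @^-1` [set s e]).
  apply/seteqP; split=> y /=.
    by move=> <- e _; rewrite /= ffunE.
  by move=> ys; apply/ffunP => e; rewrite ffunE; exact: ys.
by apply: fin_bigcap_measurable => // e _; exact: mg.
Qed.

Lemma measurable_label_iter (phi : T -> T) I (g : T -> I) n :
  measurable_fun setT phi -> measurable_label g ->
  measurable_label (g \o iter n phi).
Proof.
move=> mphi mg i; elim: n => [|n IHn] /=; first exact: mg.
rewrite -[X in measurable X]setTI.
have -> : (fun y => g (phi (iter n phi y))) @^-1` [set i] =
  phi @^-1` ((g \o iter n phi) @^-1` [set i]).
  by apply/seteqP; split=> y /=; rewrite -iterSr iterS.
exact: mphi.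
Qed.

Lemma measurable_itinerary (phi : T -> T) I (g : T -> I) n :
  measurable_fun setT phi -> measurable_label g ->
  measurable_label (itinerary phi g n).
Proof.
move=> mphi mg; apply: measurable_label_ffun => t.
exact: measurable_label_iter.
Qed.

End Labels.

Section LabelEntropy.
Context {d : measure_display} {T : measurableType d} {R : realType}.
Variable mu : probability T R.
Implicit Types (I J : finType).

Lemma label_prob_ge0 I (g : T -> I) i : 0 <= label_prob mu g i.
Proof. exact: fine_ge0. Qed.

Lemma label_prob_comp I J (g : T -> I) (h : I -> J) j : measurable_label g ->
  label_prob mu (h \o g) j = \sum_(i | h i == j) label_prob mu g i.
Proof.
move=> mg; rewrite /label_prob.
have -> : (h \o g) @^-1` [set j] =
    \bigcup_(i in [set i | h i == j]) (g @^-1` [set i]).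
  by apply/seteqP; split=> [y /= /eqP hy|y [i /= /eqP <- ->]//]; exists (g y).
rewrite measure_fin_bigcup //; first last.
- by move=> i1 i2 _ _ [y [/= <- <-]].
- exact: finite_finset.
rewrite [RHS]sum_fine; last by move=> i _; exact: fin_num_measure.
congr fine; rewrite [RHS]bigfs ?index_enum_uniq //.
by move=> i _; rewrite mem_index_enum.
Qed.

Lemma sum_label_prob I (g : T -> I) : measurable_label g ->
  \sum_i label_prob mu g i = 1.
Proof.
move=> mg; have := label_prob_comp (fun=> tt) tt mg.
rewrite /label_prob (_ : _ @^-1` _ = setT); last by apply/seteqP.
by rewrite probability_setT /= => ->; apply: eq_bigl => i; rewrite eqxx.
Qed.

Lemma label_prob_le1 I (g : T -> I) i : measurable_label g ->
  label_prob mu g i <= 1.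
Proof.
move=> mg; rewrite -(sum_label_prob mg) (bigD1 i) //= lerDl sumr_ge0 // => k _.
exact: label_prob_ge0.
Qed.

Lemma label_prob_le_comp I J (g : T -> I) (h : I -> J) i : measurable_label g ->
  label_prob mu g i <= label_prob mu (h \o g) (h i).
Proof.
move=> mg; rewrite label_prob_comp // (bigD1 i) //= lerDl sumr_ge0 // => k _.
exact: label_prob_ge0.
Qed.

Lemma sum_label_prob_comp I J (g : T -> I) (h : I -> J) (F : J -> R) :
  measurable_label g ->
  \sum_i label_prob mu g i * F (h i) = \sum_j label_prob mu (h \o g) j * F j.
Proof.
move=> mg; rewrite (partition_big h xpredT) //=.
apply: eq_bigr => j _; rewrite label_prob_comp // big_distrl /=.
by apply: eq_bigr => i /eqP ->.
Qed.

(** Jensen's inequality in the form of the inequality of Gibbs: coding the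
    values of [g] with the wrong distribution [q] can only cost more than the
    entropy. Subadditivity and the conditional estimates below come from
    suitable choices of [q]. *)
Lemma gibbs_inequality I (g : T -> I) (q : I -> R) : measurable_label g ->
  (forall i, 0 <= q i) -> \sum_i q i <= 1 ->
  (forall i, 0 < label_prob mu g i -> 0 < q i) ->
  label_entropy mu g <= \sum_i label_prob mu g i * - ln (q i).
Proof.
move=> mg q0 q1 pq; rewrite /label_entropy -subr_ge0 -sumrB.
have : 0 <= \sum_i (label_prob mu g i - q i).
  by rewrite sumrB sum_label_prob // subr_ge0.
move=> /le_trans; apply; apply: ler_sum => i _.
have [pi0|pi0] := ltrP 0 (label_prob mu g i); last first.
  have -> : label_prob mu g i = 0 by apply/le_anti; rewrite pi0 label_prob_ge0.
  by rewrite !mul0r oppr0 subr0 sub0r oppr_le0.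
have qi0 := pq _ pi0; move: (label_prob mu g i) (q i) pi0 qi0 => p r p0 r0.
have r_p : 0 < r / p by rewrite divr_gt0.
have := @le_ln1Dx R (r / p - 1); rewrite [1 + _]addrC subrK.
have -> : -1 < r / p - 1 by lra.
move=> /(_ isT); rewrite ln_div ?posrE // => lnle.
have := ler_wpM2l (ltW p0) lnle.
have -> : p * (r / p - 1) = r - p by field; rewrite gt_eqF.
rewrite mulrBr; lra.
Qed.

Lemma entropy_term_ge0 (x : R) : 0 <= x -> x <= 1 -> 0 <= - (x * ln x).
Proof.
by move=> x0 x1; rewrite oppr_ge0 mulr_ge0_le0 // ln_le0.
Qed.

Lemma label_entropy_ge0 I (g : T -> I) : measurable_label g ->
  0 <= label_entropy mu g.
Proof.
move=> mg; apply: sumr_ge0 => i _.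
by rewrite entropy_term_ge0 ?label_prob_ge0 ?label_prob_le1.
Qed.

(** Merging values increases every probability, hence decreases its cost [- ln
    p]. *)
Lemma label_entropy_comp I J (g : T -> I) (h : I -> J) : measurable_label g ->
  label_entropy mu (h \o g) <= label_entropy mu g.
Proof.
move=> mg; rewrite /label_entropy -subr_ge0.
have -> : \sum_j - (label_prob mu (h \o g) j * ln (label_prob mu (h \o g) j)) =
    \sum_i label_prob mu g i * - ln (label_prob mu (h \o g) (h i)).
  rewrite (sum_label_prob_comp _ (fun j => - ln (label_prob mu (h \o g) j))) //.
  by apply: eq_bigr => j _; rewrite mulrN.
rewrite -sumrB sumr_ge0 // => i _; rewrite -mulrN -mulrBr.
have [pi0|pi0] := ltrP 0 (label_prob mu g i); last first.
  have -> : label_prob mu g i = 0 by apply/le_anti; rewrite pi0 label_prob_ge0.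
  by rewrite mul0r.
have pj := label_prob_le_comp h i mg.
by rewrite mulr_ge0 ?label_prob_ge0 // opprK addrC subr_ge0 ler_ln ?posrE //
  (lt_le_trans pi0).
Qed.

Lemma label_entropy_factor I J (g : T -> I) (g' : T -> J) :
  measurable_label g ->
  (forall y y', g y = g y' -> g' y = g' y') ->
  label_entropy mu g' <= label_entropy mu g.
Proof.
move=> mg gg'; pose h i := g' (xget point [set y | g y = i]).
have -> : g' = h \o g.
  apply/funext => y; apply: gg'; case: xgetP => [z _ -> //|/(_ y)].
  by rewrite /= => /(_ erefl).
exact: label_entropy_comp.
Qed.

(** Coding the pair with the product of its marginals. *)
Lemma label_entropy_pair I J (g : T -> I) (h : T -> J) :
  measurable_label g -> measurable_label h ->
  label_entropy mu (fun y => (g y, h y)) <=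
  label_entropy mu g + label_entropy mu h.
Proof.
move=> mg mh; set G := fun y => (g y, h y).
have mG : measurable_label G by exact: measurable_label_pair.
pose q (ij : I * J) := label_prob mu g ij.1 * label_prob mu h ij.2.
have gG ij : 0 < label_prob mu G ij -> 0 < label_prob mu g ij.1.
  by move=> /lt_le_trans; apply; exact: (label_prob_le_comp fst).
have hG ij : 0 < label_prob mu G ij -> 0 < label_prob mu h ij.2.
  by move=> /lt_le_trans; apply; exact: (label_prob_le_comp snd).
have q0 ij : 0 <= q ij by rewrite mulr_ge0 ?label_prob_ge0.
have q1 : \sum_ij q ij <= 1.
  rewrite -(pair_bigA _ (fun i j => label_prob mu g i * label_prob mu h j)) /=.
  under eq_bigr => i _ do rewrite -mulr_sumr sum_label_prob // mulr1.
  by rewrite sum_label_prob.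
have qG ij : 0 < label_prob mu G ij -> 0 < q ij.
  by move=> pij; rewrite mulr_gt0 ?gG ?hG.
apply: (le_trans (gibbs_inequality mG q0 q1 qG)).
rewrite le_eqVlt; apply/orP; left; apply/eqP.
under eq_bigr => ij _.
  rewrite (_ : _ * _ = label_prob mu G ij * - ln (label_prob mu g ij.1) +
    label_prob mu G ij * - ln (label_prob mu h ij.2)); last first.
    have [pi0|pi0] := ltrP 0 (label_prob mu G ij); last first.
      have -> : label_prob mu G ij = 0.
        by apply/le_anti; rewrite pi0 label_prob_ge0.
      by rewrite !mul0r addr0.
    by rewrite lnM ?posrE ?gG ?hG // -mulrDr opprD.
  over.
rewrite big_split /= (sum_label_prob_comp fst (fun i =>
  - ln (label_prob mu g i))) //.
rewrite (sum_label_prob_comp snd (fun i => - ln (label_prob mu h i))) //.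
by congr (_ + _); apply: eq_bigr => i _; rewrite mulrN.
Qed.

End LabelEntropy.

(** * Entropy rates *)

(** Fekete's lemma; the values of [u] are nonnegative so that the limit is
    finite. *)
Lemma fekete (R : realType) (u : nat -> R) :
  (forall n, 0 <= u n) -> (forall n m, u (n + m)%N <= u n + u m) ->
  cvgn (fun n => u n / n%:R).
Proof.
move=> u0 uD.
have uM n m : u (n * m)%N <= n%:R * u m + u 0%N.
  elim: n => [|n IHn]; first by rewrite mul0n mul0r add0r.
  by rewrite mulSn (le_trans (uD _ _)) // -natr1 mulrDl mul1r; lra.
pose E := [set x | exists2 n, (0 < n)%N & x = u n / n%:R].
have E0 : has_inf E.
  split; first by exists (u 1%N / 1); exists 1%N.
  by exists 0 => _ [n n0 ->]; rewrite divr_ge0.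
have infE n : (0 < n)%N -> inf E <= u n / n%:R.
  by move=> n0; apply: ge_inf; [case: E0|exists n].
apply/cvg_ex; exists (inf E); apply/cvgrPdist_le => e e0.
have [_ [p p0 ->] up] : exists2 x, E x & x < inf E + e / 2.
  by apply: inf_adherent => //; rewrite divr_gt0.
have pR : 0 < p%:R :> R by rewrite ltr0n.
pose B := u 0%N + \sum_(r < p) u r.
have B0 : 0 <= B by rewrite addr_ge0 ?sumr_ge0.
near=> n.
have n0 : (0 < n)%N by near: n; exists 1%N.
have nR : 0 < n%:R :> R by rewrite ltr0n.
have := infE n n0; rewrite -subr_ge0 => un0.
rewrite distrC ger0_norm // lerBlDl.
have un : u n <= (n %/ p)%:R * u p + B.
  rewrite {1}(divn_eq n p) (le_trans (uD _ _)) //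
    (le_trans (lerD (uM _ _) (lexx _))) //.
  rewrite -addrA lerD2l lerD2l (bigD1 (Ordinal (ltn_pmod n p0))) //= lerDl.
  by rewrite sumr_ge0.
have npp : (n %/ p)%:R * u p <= n%:R * (u p / p%:R).
  rewrite mulrCA [leRHS]mulrC ler_wpM2r // ler_pdivlMr // -natrM ler_nat.
  exact: leq_trunc_div.
have Bn : B <= n%:R * (e / 2).
  rewrite -ler_pdivrMr ?divr_gt0 //; near: n; exact: nbhs_infty_ger.
rewrite ler_pdivrMr // (le_trans un) // (le_trans (lerD npp Bn)) //.
rewrite -mulrDr mulrC ler_wpM2r ?ltW //; lra.
Unshelve. all: by end_near. Qed.

Section JoinEntropy.
Context {d : measure_display} {T : measurableType d} {R : realType}.

Lemma join_entropy_label (mu : set T -> \bar R) (phi : T -> T) k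
    (g : T -> 'I_k) n :
  join_entropy mu phi (fun i => g @^-1` [set i]) n =
  label_entropy mu (itinerary phi g n).
Proof.
rewrite /join_entropy /label_entropy /label_prob.
have cellE s : join_cell phi (fun i => g @^-1` [set i]) s =
    itinerary phi g n @^-1` [set s].
  apply/seteqP; split=> y /=.
    by move=> ys; apply/ffunP => t; rewrite ffunE; exact: ys.
  by move=> <- t _ /=; rewrite ffunE.
by apply: eq_bigr => s _; rewrite cellE.
Qed.

Lemma partition_label k (P : 'I_k -> set T) : measurable_partition P ->
  exists2 g : T -> 'I_k, measurable_label g & P = fun i => g @^-1` [set i].
Proof.
move=> [[covP disP _] mP].
have cov y : exists i, P i y.
  by have : [set: T] y by []; rewrite -covP => -[i _ Pi]; exists i.
pose g y := projT1 (cid (cov y)).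
have gP y : P (g y) y by rewrite /g; case: cid.
have PE : P = fun i => g @^-1` [set i].
  apply/funext => i; apply/seteqP; split=> [y Pi|y <-]; last exact: gP.
  by apply: (disP _ _ I I); exists y; split => //; exact: gP.
by exists g => // i; move: (mP i); rewrite PE.
Qed.

(** Partitions are required to have nonempty cells, so the values not taken by
    [g] have to be removed. *)
Lemma label_partition (I : finType) (g : T -> I) : measurable_label g ->
  exists k (g' : T -> 'I_k), [/\ measurable_label g',
    measurable_partition (fun i => g' @^-1` [set i]) &
    forall y y', g' y = g' y' <-> g y = g y'].
Proof.
move=> mg; pose A := [pred i | `[< exists y, g y = i >]].
have gA y : g y \in A by apply: asboolT; exists y.
pose g' y : 'I_#|{: {i | i \in A}}| :=
  enum_rank (exist (fun i => i \in A) (g y) (gA y)).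
have gg' y y' : g' y = g' y' <-> g y = g y'.
  split=> [/enum_rank_inj []//|yy']; rewrite /g'; congr enum_rank.
  exact: val_inj.
have mg' : measurable_label g'.
  move=> j; have -> : g' @^-1` [set j] = g @^-1` [set val (enum_val j)].
    apply/seteqP; split=> y /=; first by move=> <-; rewrite enum_rankK.
    by move=> gy; apply: enum_val_inj; rewrite enum_rankK; exact: val_inj.
  exact: mg.
exists _, g'; split=> //; split=> //; split.
- by apply/seteqP; split=> // y _; exists (g' y).
- by move=> i j _ _ [y [/= <- <-]].
- move=> j _; case jE : (enum_val j) => [i iA].
  have [y gy] : exists y, g y = i by exact: asboolW iA.
  exists y => /=; apply: enum_val_inj; rewrite enum_rankK jE.
  exact: val_inj.
Qed.

Lemma label_entropy_itinerary (mu : probability T R) (phi : T -> T)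
    (I J : finType) (g : T -> I) (g' : T -> J) n :
  measurable_fun setT phi -> measurable_label g -> measurable_label g' ->
  (forall y y', g' y = g' y' <-> g y = g y') ->
  label_entropy mu (itinerary phi g' n) = label_entropy mu (itinerary phi g n).
Proof.
move=> mphi mg mg' gg'; apply/le_anti/andP; split.
all: apply: label_entropy_factor; first exact: measurable_itinerary.
all: move=> y y' /ffunP yy'; apply/ffunP => t; rewrite !ffunE.
all: by apply/gg'; have := yy' t; rewrite !ffunE.
Qed.

End JoinEntropy.

Section EntropyRate.
Context {d : measure_display} {T : measurableType d} {R : realType}.
Variables (mu : probability T R) (phi : T -> T).
Hypothesis mphi : measurable_fun setT phi.
Implicit Types (I J : finType).

Lemma cvg_entropy_rate I (g : T -> I) :
  invariant_measure mu phi -> measurable_label g ->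
  cvgn (fun n => label_entropy mu (itinerary phi g n) / n%:R).
Proof.
move=> inv mg; have mgn n : measurable_label (itinerary phi g n).
  exact: measurable_itinerary.
apply: fekete => [n|n m]; first exact: label_entropy_ge0.
have -> : label_entropy mu (itinerary phi g m) =
    label_entropy mu (itinerary phi g m \o iter n phi).
  elim: n => // n ->; rewrite /label_entropy; apply: eq_bigr => s _.
  rewrite /label_prob; set B := (itinerary phi g m \o iter n phi) @^-1` [set s].
  have -> : (itinerary phi g m \o iter n.+1 phi) @^-1` [set s] = phi @^-1` B.
    by apply/seteqP; split=> y /=; rewrite /B /= -iterSr.
  rewrite -[mu (phi @^-1` B)]/(pushforward mu phi B) inv //.
  exact: measurable_label_iter.
have mgnm : measurable_label (itinerary phi g m \o iter n phi).
  exact: measurable_label_iter.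
apply: le_trans (label_entropy_pair mu (mgn n) mgnm).
apply: label_entropy_factor; first exact: measurable_label_pair.
move=> y y' [/ffunP eqn /ffunP eqm]; apply/ffunP => t; rewrite !ffunE.
case: (ltnP t n) => [tn|nt]; first by have := eqn (Ordinal tn); rewrite !ffunE.
have tm : (t - n < m)%N by rewrite ltn_subLR.
by have := eqm (Ordinal tm); rewrite !ffunE /= -!iterD subnK.
Qed.

(** A label [L] with few values which, together with [C], predicts the itinerary
    of [Q] with rare errors shows that the itinerary has hardly more entropy
    than [C]. This is the inequality of Gibbs for the code that spends the
    entropy of [C], a uniform code for [L], and at each time gives the predicted
    symbol a probability of at least [1 - delta], every symbol keeping at least
    [delta / #|I|] so that the price of an error is bounded. *)
Lemma coding_bound I J (K : finType) n (Q : T -> I) (C : T -> J) (L : T -> K)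
    (predicted : J -> K -> 'I_n -> I) (delta : R) :
  measurable_label Q -> measurable_label C -> measurable_label L ->
  0 < delta -> delta < 1 ->
  label_entropy mu (itinerary phi Q n) <=
  label_entropy mu C + ln #|K|%:R +
  \sum_(t < n) (- ln (1 - delta) +
    fine (mu [set y | Q (iter t phi y) != predicted (C y) (L y) t]) *
      - ln (delta / #|I|%:R)).
Proof.
move=> mQ mC mL d0 d1; pose G y := (itinerary phi Q n y, (C y, L y)).
have mG : measurable_label G.
  by apply: measurable_label_pair (measurable_label_pair mC mL);
    exact: measurable_itinerary.
have card0 (X : finType) (g : T -> X) : 0 < #|X|%:R :> R.
  rewrite ltr0n lt0n; apply/negP => /eqP X0.
  have : [set: T] = set0.
    by apply/seteqP; split=> // y _; have := card0_eq X0 (g y).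
  move=> T0; have := probability_setT mu; rewrite T0 measure0 => /eqP.
  by rewrite eqe eq_sym oner_eq0.
have I0 := card0 _ Q; have K0 := card0 _ L.
pose a (t : 'I_n) (c : J) (l : K) (i : I) : R :=
  (if i == predicted c l t then 1 - delta else 0) + delta / #|I|%:R.
have a0 t c l i : 0 < a t c l i.
  by rewrite ltr_wpDl ?divr_gt0 //; case: ifP => // _; lra.
have sum_a t c l : \sum_i a t c l i = 1.
  rewrite big_split /= -big_mkcond big_pred1_eq sumr_const -[X in _ +
    X]mulr_natr divfK ?gt_eqF //.
  by rewrite subrK.
pose q (j : {ffun 'I_n -> I} * (J * K)) : R :=
  label_prob mu C j.2.1 * (#|K|%:R^-1 * \prod_t a t j.2.1 j.2.2 (j.1 t)).
have q0 j : 0 <= q j.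
  rewrite !mulr_ge0 ?label_prob_ge0 ?invr_ge0 ?ler0n ?prodr_ge0 // => t _.
  exact: ltW.
have q1 : \sum_j q j <= 1.
  rewrite -(pair_bigA _ (fun s j2 => q (s, j2))) /= exchange_big /=.
  rewrite -(pair_bigA _ (fun c l => \sum_s q (s, (c, l)))) /=.
  rewrite -(sum_label_prob mu mC); apply: ler_sum => c _.
  under eq_bigr => l _.
    rewrite /q /= -!mulr_sumr -(bigA_distr_bigA (fun t i => a t c l i)).
    under eq_bigr => t _ do rewrite sum_a.
    rewrite big1_eq mulr1; over.
  by rewrite sumr_const -[leLHS]mulr_natr -mulrA mulVf ?mulr1 // gt_eqF.
have pC j : 0 < label_prob mu G j -> 0 < label_prob mu C j.2.1.
  by move=> /lt_le_trans; apply; exact: (label_prob_le_comp _ (fst \o snd)).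
have qG j : 0 < label_prob mu G j -> 0 < q j.
  move=> /pC pj; rewrite !mulr_gt0 ?invr_gt0 ?prodr_gt0 // => t _; exact: a0.
apply: le_trans (label_entropy_comp mu fst mG) _.
apply: (le_trans (gibbs_inequality mG q0 q1 qG)).
pose miss t (j : {ffun 'I_n -> I} * (J * K)) := j.1 t != predicted j.2.1 j.2.2
  t.
pose c1 := - ln (1 - delta); pose c2 := - ln (delta / #|I|%:R).
have c10 : 0 <= c1 by rewrite /c1 oppr_ge0 ln_le0 //; lra.
have c20 : 0 <= c2.
  rewrite /c2 oppr_ge0 ln_le0 // ler_pdivrMr // mul1r (le_trans (ltW d1)) //.
  by rewrite ler1n -(ltr0n R).
have lna t (j : {ffun 'I_n -> I} * (J * K)) : - ln (a t j.2.1 j.2.2 (j.1 t)) <=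
  c1 + (miss t j)%:R * c2.
  have dI : 0 < delta / #|I|%:R by rewrite divr_gt0.
  rewrite /miss /a; case: eqP => _ /=; rewrite ?mul0r ?mul1r ?addr0 ?add0r.
    by rewrite /c1 lerN2 ler_ln ?posrE; lra.
  by rewrite /c2; lra.
apply: (@le_trans _ _ (\sum_j (label_prob mu G j * - ln (label_prob mu C j.2.1)
  +
   (label_prob mu G j * ln #|K|%:R +
    \sum_t label_prob mu G j * (c1 + (miss t j)%:R * c2))))).
  apply: ler_sum => j _; rewrite -mulr_sumr -!mulrDr.
  have [p0|p0] := ltrP 0 (label_prob mu G j); last first.
    have -> : label_prob mu G j = 0 by apply/le_anti; rewrite p0 label_prob_ge0.
    by rewrite !mul0r.
  have prod0 : 0 < \prod_t a t j.2.1 j.2.2 (j.1 t) by rewrite prodr_gt0.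
  rewrite ler_wpM2l ?label_prob_ge0 // /q.
  rewrite lnM ?posrE ?pC ?mulr_gt0 ?invr_gt0 // lnM ?posrE ?invr_gt0 //.
  rewrite lnV ?posrE // !opprD opprK lerD2l lerD2l.
  have -> : ln (\prod_t a t j.2.1 j.2.2 (j.1 t)) = \sum_t ln (a t j.2.1 j.2.2
    (j.1 t)).
    elim/big_rec2 : _ prod0 => [|t x y _ IH]; first by rewrite ln1.
    rewrite pmulr_rgt0 // => y0; rewrite lnM ?posrE //; congr (_ + _).
    exact: IH.
  by rewrite -sumrN; apply: ler_sum => t _; exact: lna.
rewrite big_split /= (sum_label_prob_comp mu (fst \o snd) (fun c =>
  - ln (label_prob mu C c))) //.
rewrite -addrA lerD //.
  by rewrite le_eqVlt; apply/orP; left; apply/eqP; apply: eq_bigr => i _;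
    rewrite mulrN.
rewrite big_split /= -mulr_suml sum_label_prob // mul1r lerD2l exchange_big /=.
apply: ler_sum => t _.
under eq_bigr do rewrite mulrDr.
rewrite big_split /= -mulr_suml sum_label_prob // mul1r lerD2l.
under eq_bigr do rewrite mulrA.
rewrite -mulr_suml ler_wpM2r //.
rewrite (sum_label_prob_comp mu (miss t) (fun b : bool => b%:R)) // big_bool /=.
rewrite mulr1 mulr0 addr0 /label_prob.
rewrite (_ : _ @^-1` _ = [set y | Q (iter t phi y) != predicted (C y) (L y) t])
  //.
by apply/seteqP; split=> y /=; rewrite /miss /= ffunE.
Qed.

End EntropyRate.

(** * Moduli of complex numbers *)

Section ComplexModulus.
Context {R : realType}.
Implicit Types (z : R[i]).

(** The norm on [R[i]] has values in [R[i]]; estimates need its value in [R]. *)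
Definition cmod z : R := complex.Re `|z|.

Lemma cmodE z : `|z| = (cmod z)%:C%C.
Proof. by rewrite /cmod normc_def. Qed.

Lemma cmod_ge0 z : 0 <= cmod z.
Proof. by have := normr_ge0 z; rewrite cmodE ler0c. Qed.

Lemma cmodM z1 z2 : cmod (z1 * z2) = cmod z1 * cmod z2.
Proof. by apply: complexI; rewrite rmorphM /= -!cmodE normrM. Qed.

Lemma cmodX z n : cmod (z ^+ n) = cmod z ^+ n.
Proof. by apply: complexI; rewrite rmorphXn /= -!cmodE normrX. Qed.

Lemma cmodV z : cmod z^-1 = (cmod z)^-1.
Proof. by apply: complexI; rewrite fmorphV /= -!cmodE normfV. Qed.

Lemma cmod_expz z (n : int) : cmod (z ^ n) = cmod z ^ n.
Proof. by case: n => n; rewrite ?NegzE -?exprnP -?exprnN ?cmodV cmodX. Qed.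

Lemma cmodN z : cmod (- z) = cmod z.
Proof. by rewrite /cmod normrN. Qed.

Lemma cmod0 : cmod 0 = 0 :> R.
Proof. by rewrite /cmod normr0. Qed.

Lemma cmod_sum (I : Type) (r : seq I) (P : pred I) (F : I -> R[i]) :
  cmod (\sum_(i <- r | P i) F i) <= \sum_(i <- r | P i) cmod (F i).
Proof.
rewrite -lecR -cmodE rmorph_sum /= (le_trans (ler_norm_sum _ _ _)) //.
Qed.

Lemma normr_Re z : `|complex.Re z| <= cmod z.
Proof. by rewrite -lecR -cmodE normc_ge_Re. Qed.

Lemma cmod_real (x : R) : cmod x%:C%C = `|x|.
Proof. by rewrite /cmod normc_def /= expr0n addr0 sqrtr_sqr. Qed.

Lemma cmod_eq1 z : (`|z| = 1) <-> (cmod z = 1).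
Proof. by rewrite cmodE; split=> [[]//|->]. Qed.

Lemma cmod_lt1 z : (`|z| < 1) = (cmod z < 1).
Proof. by rewrite cmodE -ltcR. Qed.

Lemma cmod_gt1 z : (1 < `|z|) = (1 < cmod z).
Proof. by rewrite cmodE -ltcR. Qed.

End ComplexModulus.

(** * Polynomials acting on two-sided sequences *)

Section PolynomialAction.
Context {K : comNzRingType}.
Implicit Types (p q : {poly K}) (w : int -> K).

Definition poly_act p w : int -> K := fun k => \sum_(j < size p) p`_j * w (k +
  j%:Z).

Lemma poly_act_widen N p w k : (size p <= N)%N ->
  poly_act p w k = \sum_(j < N) p`_j * w (k + j%:Z).
Proof.
move=> pN; rewrite /poly_act (big_ord_widen N (fun j =>
  p`_j * w (k + j%:Z))) //.
rewrite big_mkcond; apply: eq_bigr => j _; case: ltnP => // /leq_sizeP -> //.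
by rewrite mul0r.
Qed.

Lemma poly_actD p q w k : poly_act (p + q) w k = poly_act p w k + poly_act q w
  k.
Proof.
pose N := maxn (size p) (size q).
rewrite !(@poly_act_widen N) ?leq_maxl ?leq_maxr ?size_polyD // -big_split /=.
by apply: eq_bigr => j _; rewrite coefD mulrDl.
Qed.

Lemma poly_actZ c p w k : poly_act (c *: p) w k = c * poly_act p w k.
Proof.
rewrite !(@poly_act_widen (size p)) ?size_scale_leq // mulr_sumr.
by apply: eq_bigr => j _; rewrite coefZ mulrA.
Qed.

Lemma poly_act_sum (I : Type) (r : seq I) (F : I -> {poly K}) w k :
  poly_act (\sum_(i <- r) F i) w k = \sum_(i <- r) poly_act (F i) w k.
Proof.
elim/big_rec2 : _ => [|i p x _ <-]; last by rewrite poly_actD.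
by rewrite /poly_act size_poly0 big_ord0.
Qed.

Lemma poly_actC c w k : poly_act c%:P w k = c * w k.
Proof.
by rewrite (@poly_act_widen 1) ?size_polyC_leq1 // big_ord1 coefC addr0.
Qed.

Lemma poly_actMX p w k : poly_act (p * 'X) w k = poly_act p w (k + 1).
Proof.
rewrite (@poly_act_widen (size p).+1); last first.
  by have := size_polyMleq p 'X; rewrite size_polyX addn2.
rewrite big_ord_recl coefMX /= mul0r add0r; apply: eq_bigr => j _.
by rewrite coefMX /= -addrA.
Qed.

Lemma poly_actM p q w k : poly_act (p * q) w k = poly_act p (poly_act q w) k.
Proof.
elim/poly_ind: p k => [|p c IHp] k.
  by rewrite mul0r -polyC0 !poly_actC !mul0r.
rewrite mulrDl !poly_actD mulrAC !poly_actMX IHp poly_actC; congr (_ + _).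
by rewrite mul_polyC poly_actZ.
Qed.

Lemma poly_act_XsubC z w k : poly_act ('X - z%:P) w k = w (k + 1) - z * w k.
Proof.
by rewrite poly_actD -['X]mul1r poly_actMX -polyCN -polyC1 !poly_actC mul1r
  mulNr.
Qed.

Lemma eq_poly_act p w w' : w =1 w' -> poly_act p w =1 poly_act p w'.
Proof. by move=> ww' k; apply: eq_bigr => j _; rewrite ww'. Qed.

Lemma poly_act_lin (I : Type) (r : seq I) p (c : I -> K) (W : I -> int -> K) k :
  poly_act p (fun n => \sum_(i <- r) c i * W i n) k =
  \sum_(i <- r) c i * poly_act p (W i) k.
Proof.
rewrite /poly_act; under eq_bigr do rewrite mulr_sumr.
rewrite exchange_big /=; apply: eq_bigr => i _; rewrite mulr_sumr.
by apply: eq_bigr => j _; rewrite mulrCA.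
Qed.

End PolynomialAction.

Lemma poly_eq0_horner (K : numFieldType) (p : {poly K}) :
  (forall x, p.[x] = 0) -> p = 0.
Proof.
move=> p0; apply: (@roots_geq_poly_eq0 _ p [seq i%:R | i <- iota 0 (size p)]).
- by apply/allP => x _; apply/rootP.
- rewrite map_inj_uniq ?iota_uniq // => i j /eqP; rewrite eqr_nat.
  by move/eqP.
- by rewrite size_map size_iota.
Qed.

(** * Partial fractions and fundamental solutions *)

Section PartialFractions.
Context {R : realType}.
Variables (f : {poly int}) (b : R[i] -> R[i]).
Hypothesis f_monic : f \is monic.
Hypothesis fb : partial_fractions f b.

Local Notation fC := (map_poly intr f : {poly R[i]}).

Lemma fC_neq0 : fC != 0.
Proof. by rewrite map_poly_eq0_id0 ?(monicP f_monic) ?oner_eq0 //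
  monic_neq0. Qed.

Lemma Omega_seq : {rs : seq R[i] | uniq rs & forall z, (z \in rs) = root fC z}.
Proof.
have [r fr] := closed_field_poly_normal fC.
exists (undup r); first exact: undup_uniq.
move=> z; rewrite mem_undup fr rootZ ?lead_coef_eq0 ?fC_neq0 //.
by rewrite root_prod_XsubC.
Qed.

Definition Omegas : seq R[i] := s2val Omega_seq.

Lemma Omegas_uniq : uniq Omegas.
Proof. exact: (s2valP Omega_seq). Qed.

Lemma mem_Omegas z : (z \in Omegas) = root fC z.
Proof. exact: (s2valP' Omega_seq). Qed.

Lemma sum_Omega (A : set R[i]) (F : R[i] -> R[i]) : A `<=` Omega f ->
  \sum_(z \in A) F z = \sum_(z <- Omegas | z \in A) F z.
Proof.
move=> Af; rewrite [RHS]bigfs ?Omegas_uniq //; last first.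
  by move=> z /set_mem /Af; rewrite mem_Omegas => ->.
by apply: eq_fsbigl; apply/seteqP; split=> z /=; rewrite inE.
Qed.

Definition cofactor_poly z := fC %/ ('X - z%:P).

Lemma cofactor_polyE z : z \in Omegas -> cofactor_poly z * ('X - z%:P) = fC.
Proof. by rewrite mem_Omegas root_factor_theorem => /divpK. Qed.

Lemma size_cofactor_poly z : (size (cofactor_poly z) <= (size f).-1)%N.
Proof.
by rewrite size_divp ?polyXsubC_eq0 // size_XsubC subn1 -(size_map_inj_poly
  (@intr_inj R[i])) ?rmorph0.
Qed.

(** Lagrange interpolation of the constant [1], which is the partial fraction
    decomposition cleared of its denominator. *)
Lemma sum_cofactor_poly : \sum_(z <- Omegas) b z *: cofactor_poly z = 1.
Proof.
apply/eqP; rewrite -subr_eq0; set p := _ - 1.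
suff : p * fC == 0 by rewrite mulf_eq0 (negPf fC_neq0) orbF.
apply/eqP/poly_eq0_horner => u; rewrite hornerM.
have [uf|uf] := boolP (root fC u); first by rewrite (rootP uf) mulr0.
have fu0 : fC.[u] != 0 by [].
have := fb (u := u); rewrite (monicP f_monic) invr1 mul1r sum_Omega //.
move=> /(_ (elimN idP uf)) fuV.
rewrite /p hornerD hornerN hornerC horner_sum.
suff -> : \sum_(z <- Omegas) (b z *: cofactor_poly z).[u] = 1 by rewrite subrr
  mul0r.
rewrite -(mulfV fu0) fuV mulr_sumr big_seq [RHS]big_seq_cond.
apply: eq_big => [z|z zO].
  have [zO|] := boolP (z \in Omegas); last by [].
  by apply/esym/mem_set; rewrite /Omega /= -mem_Omegas.
have uz : u - z != 0.
  by rewrite subr_eq0; apply: contraNneq uf => ->; rewrite -mem_Omegas.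
rewrite hornerZ -(cofactor_polyE zO) hornerM hornerXsubC.
by rewrite -mulrA (mulrC (b z) (_^-1)) mulVKf // mulrC.
Qed.

(** The solution of [(sigma - z) w = delta_0] which is supported in the future
    if [z] is in [A], and in the past otherwise. Both homoclinic points are the
    real parts of the corresponding solutions for [f], with [A] the open,
    respectively closed, unit disc. *)
Definition fundamental_term (A : pred R[i]) z (n : int) : R[i] :=
  if A z then (if 1 <= n then z ^ (n - 1) else 0)
  else (if 1 <= n then 0 else - z ^ (n - 1)).

Definition fundamental (A : pred R[i]) (n : int) : R[i] :=
  \sum_(z <- Omegas) b z * fundamental_term A z n.

Lemma fundamental_term_XsubC (A : pred R[i]) z k : (~~ A z -> z != 0) ->
  poly_act ('X - z%:P) (fundamental_term A z) k = (k == 0)%:R.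
Proof.
move=> z0; rewrite poly_act_XsubC /fundamental_term addrK.
case: (ifPn (A z)) => [_|/z0 {}z0].
  have [k1|k1] := lerP 1 k.
    have -> : 1 <= k + 1 by lia.
    have -> : (k == 0) = false by lia.
    case: k k1 => // -[//|k] _; rewrite -addn1 PoszD addrK -!exprnP.
    by rewrite addn1 exprS subrr.
  have [k2|k2] := lerP 1 (k + 1).
    have -> : k = 0 by lia.
    by rewrite expr0z mulr0 subr0.
  have -> : (k == 0) = false by lia.
  by rewrite mulr0 subr0.
have [k1|k1] := lerP 1 k.
  have -> : 1 <= k + 1 by lia.
  have -> : (k == 0) = false by lia.
  by rewrite mulr0 subr0.
have zk : z * z ^ (k - 1) = z ^ k by rewrite -{1}[z]expr1z -expfzDr //
  addrC subrK.
have [k2|k2] := lerP 1 (k + 1).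
  have k0 : k = 0 by lia.
  by rewrite mulrN zk k0 expr0z sub0r opprK.
have -> : (k == 0) = false by lia.
by rewrite mulrN zk opprK addrC subrr.
Qed.

(** Applying [f(sigma)] leaves [\sum_z b_z q_z(sigma) delta_0] with the
    cofactors [q_z] of [f], and these combine to the constant [1]. *)
Lemma poly_act_fundamental (A : pred R[i]) k :
  (forall z, z \in Omegas -> ~~ A z -> z != 0) ->
  poly_act fC (fundamental A) k = (k == 0)%:R.
Proof.
move=> A0; rewrite poly_act_lin.
rewrite -[RHS]mul1r -(poly_actC 1 (fun k => (k == 0)%:R)) polyC1 -[X in poly_act
  X _ _]sum_cofactor_poly.
rewrite poly_act_sum big_seq [RHS]big_seq; apply: eq_bigr => z zO.
rewrite poly_actZ -(cofactor_polyE zO) poly_actM; congr (_ * _).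
by apply: eq_poly_act => n; rewrite fundamental_term_XsubC //; exact: A0.
Qed.

End PartialFractions.

(** * The homoclinic points and the space W0 *)

Section RecurrenceSolutions.
Context {R : realType}.
Variables (f : {poly int}) (b : R[i] -> R[i]).
Hypothesis f_monic : f \is monic.
Hypothesis fb : partial_fractions f b.

Local Notation fC := (map_poly intr f : {poly R[i]}).

Lemma poly_shift_Re (w : int -> R[i]) k :
  poly_shift f (fun n => complex.Re (w n)) k = complex.Re (poly_act fC w k).
Proof.
rewrite /poly_shift /poly_act size_map_inj_poly ?rmorph0 //;
  last exact: intr_inj.
rewrite (raddf_sum (@complex.Re R : Rcomplex R -> R)); apply: eq_bigr => j _.
by rewrite coef_map /= mulrzl (raddfMz (@complex.Re R : Rcomplex R -> R)).
Qed.

Lemma poly_shiftB (w w' : int -> R) k :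
  poly_shift f (fun n => w n - w' n) k = poly_shift f w k - poly_shift f w' k.
Proof. by rewrite -sumrB; apply: eq_bigr => j _; rewrite mulrzBl. Qed.

Lemma poly_shift_translate (w : int -> R) l k :
  poly_shift f (fun n => w (n + l)) k = poly_shift f w (k + l).
Proof. by apply: eq_bigr => j _; rewrite /zshift addrAC. Qed.

Lemma delta_sumE (A : set R[i]) n : A `<=` Omega f ->
  delta_sum f b A n =
  complex.Re (\sum_(z <- Omegas f_monic | z \in A) b z * z ^ (n - 1)).
Proof.
by move=> Af; rewrite /delta_sum (monicP f_monic) invr1 mul1r (sum_Omega
  f_monic).
Qed.

Lemma w_delta_plusE n : w_delta_plus f b n =
  complex.Re (fundamental b f_monic (fun z => cmod z < 1) n).
Proof.
rewrite /w_delta_plus /fundamental /fundamental_term; case: ifP => n1.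
  rewrite delta_sumE; last by move=> z [].
  rewrite big_mkcond; congr complex.Re; rewrite big_seq [RHS]big_seq.
  apply: eq_bigr => z; rewrite mem_Omegas => zO; case: ifPn => [/set_mem[_]|].
    by rewrite cmod_lt1 => ->.
  rewrite notin_setE /Omega_minus /=.
  by case: ifP => [z1 []|]; rewrite ?cmod_lt1 // mulr0.
rewrite delta_sumE; last by move=> z [[]|[]].
rewrite -(raddfN (@complex.Re R : Rcomplex R -> R)) big_mkcond -sumrN.
congr complex.Re; rewrite big_seq [RHS]big_seq.
apply: eq_bigr => z; rewrite mem_Omegas => zO; case: ifPn => [/set_mem|].
  by case=> -[_]; [move/cmod_eq1|rewrite cmod_gt1] => z1;
    rewrite ltNge ?z1 ?lexx ?(ltW z1) //= mulrN.
rewrite notin_setE oppr0; case: ltgtP => [|z1|z1]; rewrite ?mulr0 //.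
  by case; right; split=> //; rewrite cmod_gt1.
by case; left; split=> //; apply/cmod_eq1.
Qed.

Lemma w_delta_minusE n : w_delta_minus f b n =
  complex.Re (fundamental b f_monic (fun z => cmod z <= 1) n).
Proof.
rewrite /w_delta_minus /fundamental /fundamental_term; case: ifP => n1.
  rewrite delta_sumE; last by move=> z [[]|[]].
  rewrite big_mkcond; congr complex.Re; rewrite big_seq [RHS]big_seq.
  apply: eq_bigr => z; rewrite mem_Omegas => zO; case: ifPn => [/set_mem|].
    by case=> -[_]; [rewrite cmod_lt1 => /ltW ->|move/cmod_eq1 => ->;
      rewrite lexx].
  rewrite notin_setE; case: ltgtP => [z1|z1|z1]; rewrite ?mulr0 //.
    by case; left; split=> //; rewrite cmod_lt1.
  by case; right; split=> //; apply/cmod_eq1.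
rewrite delta_sumE; last by move=> z [].
rewrite -(raddfN (@complex.Re R : Rcomplex R -> R)) big_mkcond -sumrN.
congr complex.Re; rewrite big_seq [RHS]big_seq.
apply: eq_bigr => z; rewrite mem_Omegas => zO; case: ifPn => [/set_mem[_]|].
  by rewrite cmod_gt1 ltNge => /negPf ->; rewrite mulrN.
rewrite notin_setE oppr0; case: lerP => [|z1 []]; rewrite ?mulr0 //.
by split=> //; rewrite cmod_gt1.
Qed.

Lemma cmod_gt0_neq0 (z : R[i]) : 0 < cmod z -> z != 0.
Proof. by apply: contraTneq => ->; rewrite cmod0 ltxx. Qed.

Lemma poly_shift_w_delta_plus k :
  poly_shift f (w_delta_plus f b) k = (k == 0)%:R.
Proof.
rewrite (_ : w_delta_plus f b = fun n => complex.Re (fundamental b f_monic (fun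
  z => cmod z < 1) n)); last exact/funext/w_delta_plusE.
rewrite poly_shift_Re poly_act_fundamental //; first by case: eqP.
by move=> z _; rewrite -leNgt => z1; rewrite cmod_gt0_neq0 //
  (lt_le_trans ltr01).
Qed.

Lemma poly_shift_w_delta_minus k :
  poly_shift f (w_delta_minus f b) k = (k == 0)%:R.
Proof.
rewrite (_ : w_delta_minus f b = fun n => complex.Re (fundamental b f_monic (fun
  z => cmod z <= 1) n)); last exact/funext/w_delta_minusE.
rewrite poly_shift_Re poly_act_fundamental //; first by case: eqP.
by move=> z _; rewrite -ltNge => z1; rewrite cmod_gt0_neq0 // (lt_trans ltr01).
Qed.

Definition w_delta_zero : zseq R := fun n => w_delta_minus f b n - w_delta_plus
  f b n.

Lemma bounded_funP (w : zseq R) : linfR w <-> exists B, forall n, `|w n| <= B.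
Proof.
split=> [/ex_bound[|B wB]|[B wB]].
- exact: (@globally_properfilter _ _ (0 : int)).
- by exists B => n; exact: wB.
- apply/ex_bound; first exact: (@globally_properfilter _ _ (0 : int)).
  by exists B => n _; exact: wB.
Qed.

(** Only the roots of modulus one contribute to the difference, and their powers
    are bounded in both directions. *)
Lemma w_delta_zero_W0 : W0 f w_delta_zero.
Proof.
split; last first.
  move=> n; rewrite /w_delta_zero poly_shiftB poly_shift_w_delta_minus.
  by rewrite poly_shift_w_delta_plus subrr.
apply/bounded_funP; exists (\sum_(z <- Omegas f_monic) cmod (b z)) => n.
rewrite /w_delta_zero w_delta_minusE w_delta_plusE.
rewrite -(raddfB (@complex.Re R : Rcomplex R -> R)) (le_trans (normr_Re _)) //.
rewrite /fundamental -sumrB (le_trans (cmod_sum _ _ _)) //.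
apply: ler_sum => z _; rewrite -mulrBr cmodM ler_piMr ?cmod_ge0 //.
rewrite /fundamental_term; case: ltgtP => z1; rewrite ?subrr ?cmod0 //.
have zn1 : cmod (z ^ (n - 1)) = 1 by rewrite cmod_expz z1 exp1rz.
by case: ifP; rewrite ?subr0 ?sub0r ?opprK zn1.
Qed.

(** Here [a] is the modulus of an eigen-sequence of the shift: a two-sided
    bounded orbit of a dilation vanishes unless the ratio is [1]. *)
Lemma bounded_geometric_le (a : int -> R) (r M : R) : 0 <= r ->
  (forall k, 0 <= a k <= M) -> (forall k, a (k + 1) = r * a k) ->
  forall k, a k <= a 0.
Proof.
move=> r0 aM ar.
have arn k (n : nat) : a (k + n%:Z) = r ^+ n * a k.
  elim: n => [|n IHn]; first by rewrite addr0 expr0 mul1r.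
  by rewrite -addn1 PoszD addrA ar IHn addn1 exprS mulrA.
have a_ge0 k : 0 <= a k by case/andP: (aM k).
have aleM k : a k <= M by case/andP: (aM k).
have M0 : 0 <= M := le_trans (a_ge0 0) (aleM 0).
have vanish s (x : R) : 0 <= s -> s < 1 -> (forall n, x <= s ^+ n * M) ->
  x <= 0.
  move=> s0 s1 xs; apply/ler_addgt0Pl => e e0; rewrite addr0.
  have : (fun n => s ^+ n * M) @ \oo --> 0 * M.
    by apply: cvgMl; apply: cvg_expr; rewrite ger0_norm.
  rewrite mul0r => /cvgrPdist_le/(_ _ e0)[N _ /(_ N (leqnn N))] /=.
  rewrite sub0r normrN ger0_norm ?mulr_ge0 ?exprn_ge0 //.
  exact: le_trans.
move=> k; case: (ltgtP r 1) => r1.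
- apply: le_trans (a_ge0 0); apply: (vanish r) => // n.
  by rewrite -{1}[k](subrK n%:Z) arn ler_wpM2l ?exprn_ge0.
- apply: le_trans (a_ge0 0); apply: (vanish r^-1);
  rewrite ?invr_ge0 ?invf_lt1 //.
    exact: lt_trans r1.
  move=> n; rewrite exprVn mulrC ler_pdivlMr ?exprn_gt0 ?(lt_trans _ r1) //.
  by rewrite mulrC -arn.
- case: (lerP 0 k) => k0.
    by rewrite -[k]gez0_abs // -[`|k|%N%:Z]add0r arn r1 expr1n mul1r.
  have -> : a 0 = a (k + `|k|%N%:Z) by congr a; lia.
  by rewrite arn r1 expr1n mul1r.
Qed.

(** The components [q_z(sigma) w] along the roots are bounded eigen-sequences of
    the shift, so that their moduli are largest at time [0], where they are seen
    in one window of [w]; their combination with coefficients [b z] is [w]. *)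
Lemma W0_window_bound : exists2 C : R, 0 <= C &
  forall (w : zseq R) e, W0 f w -> (forall j, (j < (size f).-1)%N ->
    `|w j%:Z| <= e) ->
  forall n, `|w n| <= C * e.
Proof.
pose q := @cofactor_poly R f.
pose C := \sum_(z <- Omegas f_monic) cmod (b z) *
   \sum_(j < size (q z)) cmod (q z)`_j.
exists C; first by rewrite sumr_ge0 // => z _; rewrite mulr_ge0 ?cmod_ge0
  ?sumr_ge0 // => j _; exact: cmod_ge0.
move=> w e [/bounded_funP[B wB] fw] we n.
pose wc k : R[i] := (w k)%:C%C.
have fwc k : poly_act fC wc k = 0.
  have -> : poly_act fC wc k = (poly_shift f w k)%:C%C.
    rewrite /poly_shift /poly_act size_map_inj_poly ?rmorph0 //;
      last exact: intr_inj.
    rewrite rmorph_sum; apply: eq_bigr => j _.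
    by rewrite coef_map /= mulrzl /wc rmorphMz.
  by rewrite fw.
have bound z k e' : (forall j, (j < size (q z))%N -> `|w (k + j%:Z)| <= e') ->
    cmod (poly_act (q z) wc k) <= (\sum_(j < size (q z)) cmod (q z)`_j) * e'.
  move=> we'; rewrite (le_trans (cmod_sum _ _ _)) // mulr_suml.
  by apply: ler_sum => j _; rewrite cmodM ler_wpM2l ?cmod_ge0 // cmod_real we'.
have dilation z k : z \in Omegas f_monic ->
    cmod (poly_act (q z) wc k) <= cmod (poly_act (q z) wc 0).
  move=> zO; apply: (@bounded_geometric_le (fun k =>
    cmod (poly_act (q z) wc k)) (cmod z)
    ((\sum_(j < size (q z)) cmod (q z)`_j) * B)); first exact: cmod_ge0.
    by move=> l; rewrite cmod_ge0 /= bound.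
  move=> l; rewrite -cmodM; congr cmod; apply/eqP.
  rewrite -subr_eq0 -poly_act_XsubC -poly_actM mulrC.
  by rewrite (cofactor_polyE zO) fwc.
rewrite -cmod_real -[X in cmod X]/(wc n) -[wc n]mul1r -(poly_actC 1 wc) polyC1.
rewrite -(sum_cofactor_poly f_monic fb) poly_act_sum (le_trans (cmod_sum _ _ _))
  //.
rewrite /C mulr_suml big_seq [leRHS]big_seq; apply: ler_sum => z zO.
rewrite poly_actZ cmodM -mulrA ler_wpM2l ?cmod_ge0 //
  (le_trans (dilation _ _ zO)) //.
rewrite bound // => j jq; rewrite add0r we //.
exact: leq_trans jq (size_cofactor_poly f z).
Qed.

End RecurrenceSolutions.

(** * Convergence of xi_star *)

Section GeometricDecay.
Context {R : realType}.
Implicit Types (a u : nat -> R).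

Definition geometric_decay a :=
  exists G r : R, [/\ 0 < r, r < 1 & forall n, `|a n| <= G * r ^+ n].

Lemma geometric_decay_le a a' : (forall n, `|a n| <= `|a' n|) ->
  geometric_decay a' -> geometric_decay a.
Proof.
by move=> aa' [G [r [r0 r1 a'r]]]; exists G, r; split=> // n;
  exact: le_trans (aa' n) _.
Qed.

Lemma geometric_decay_near a N (G r : R) : 0 < r -> r < 1 ->
  (forall n, (N <= n)%N -> `|a n| <= G * r ^+ n) -> geometric_decay a.
Proof.
move=> r0 r1 ar; exists (`|G| + \sum_(i < N) `|a i| / r ^+ i), r; split=> // n.
have rn i : 0 < r ^+ i by rewrite exprn_gt0.
have S0 : 0 <= \sum_(i < N) `|a i| / r ^+ i.
  by apply: sumr_ge0 => i _; rewrite divr_ge0 // ltW.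
have [Nn|nN] := leqP N n.
  rewrite (le_trans (ar n Nn)) // ler_wpM2r ?(ltW (rn n)) //.
  by rewrite (le_trans (ler_norm G)) // lerDl.
rewrite -ler_pdivrMr // (bigD1 (Ordinal nN)) //= addrCA lerDl addr_ge0 //.
by apply: sumr_ge0 => i _; rewrite divr_ge0 // ltW.
Qed.

Lemma geometric_decayD a a' : geometric_decay a -> geometric_decay a' ->
  geometric_decay (fun n => a n + a' n).
Proof.
move=> [G [r [r0 r1 ar]]] [G' [r' [r'0 r'1 a'r']]].
have Gge0 (x : nat -> R) (g s : R) : (forall n, `|x n| <= g * s ^+ n) -> 0 <= g.
  by move=> /(_ 0%N); rewrite expr0 mulr1; exact: le_trans.
exists (G + G'), (Num.max r r'); split; rewrite ?lt_max ?r0 ?gt_max ?r1 //.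
move=> n; rewrite mulrDl (le_trans (ler_normD _ _)) // lerD //.
  rewrite (le_trans (ar n)) // ler_wpM2l ?(Gge0 _ _ _ ar) //.
  by rewrite lerXn2r ?nnegrE ?(ltW r0) ?le_max ?lexx ?(ltW r0).
rewrite (le_trans (a'r' n)) // ler_wpM2l ?(Gge0 _ _ _ a'r') //.
by rewrite lerXn2r ?nnegrE ?(ltW r'0) ?le_max ?lexx ?(ltW r'0) ?orbT.
Qed.

Lemma geometric_decayZ c a : geometric_decay a -> geometric_decay (fun n =>
  c * a n).
Proof.
move=> [G [r [r0 r1 ar]]]; exists (`|c| * G), r; split=> // n.
by rewrite normrM -mulrA ler_wpM2l.
Qed.

Lemma geometric_decay0 : geometric_decay (fun=> 0).
Proof.
exists 0, (1 / 2); split; [lra|lra|] => n.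
by rewrite normr0 mul0r.
Qed.

Lemma geometric_decay_sum (I : eqType) (s : seq I) (F : I -> nat -> R) :
  (forall i, i \in s -> geometric_decay (F i)) ->
  geometric_decay (fun n => \sum_(i <- s) F i n).
Proof.
elim: s => [|i s IHs] Fs.
  by under [X in geometric_decay X]eq_fun do rewrite big_nil;
    exact: geometric_decay0.
under [X in geometric_decay X]eq_fun do rewrite big_cons.
apply: geometric_decayD; first by apply: Fs; rewrite mem_head.
by apply: IHs => j js; apply: Fs; rewrite inE js orbT.
Qed.

Definition pairing u a N : R := \sum_(0 <= n < N) u n * a n.

(** The constants do not depend on [u]: this uniformity is what makes the limit
    continuous in [u]. *)
Lemma pairing_cvg a : geometric_decay a ->
  exists G r : R, [/\ 0 < r, r < 1 & forall u B, (forall n, `|u n| <= B) ->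
    cvgn (pairing u a) /\
    forall N, `|limn (pairing u a) - pairing u a N| <= B * (G * r ^+ N)].
Proof.
move=> [G [r [r0 r1 ar]]]; exists (G / (1 - r)), r; split=> // u B uB.
have G0 : 0 <= G by have := ar 0%N; rewrite expr0 mulr1; exact: le_trans.
have B0 : 0 <= B := le_trans (normr_ge0 _) (uB 0%N).
have r10 : 0 < 1 - r by rewrite subr_gt0.
have ua n : `|u n * a n| <= B * G * r ^+ n.
  by rewrite normrM -mulrA ler_pM.
have cvgp : cvgn (pairing u a).
  apply: (@normed_cvg _ R (fun n => u n * a n)).
  apply: (@series_le_cvg _ _ (geometric (B * G) r)) => [n|n|n|] /=; first by [].
  - by rewrite !mulr_ge0 // exprn_ge0 // ltW.
  - exact: ua.
  - by apply: is_cvg_geometric_series; rewrite ger0_norm // ltW.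
split=> // N.
have tail M : (N <= M)%N ->
    `|pairing u a M - pairing u a N| <= B * (G / (1 - r) * r ^+ N).
  move=> NM; rewrite /pairing (@big_cat_nat _ _ _ N 0%N M) //= addrAC subrr
    add0r.
  rewrite (le_trans (ler_norm_sum _ _ _)) //.
  apply: (@le_trans _ _ (\sum_(N <= n < M) B * G * r ^+ n));
    first exact: ler_sum.
  rewrite -mulr_sumr.
  have -> : \sum_(N <= n < M) r ^+ n = (r ^+ N - r ^+ M) / (1 - r).
    apply: (@mulIf _ (1 - r)); first by rewrite gt_eqF.
    rewrite divfK ?gt_eqF // mulr_suml -[in RHS]opprB -(telescope_sumr (fun n =>
      r ^+ n) NM) -sumrN.
    by apply: eq_bigr => n _; rewrite opprB mulrBr mulr1 -exprSr.
  rewrite !mulrA -mulrA [leRHS]mulrAC -[leRHS]mulrA ler_wpM2l ?mulr_ge0 //.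
  by rewrite ler_pM2r ?invr_gt0 // gerBl exprn_ge0 // ltW.
have cvgn1 : `|pairing u a M - pairing u a N| @[M --> \oo] -->
    `|limn (pairing u a) - pairing u a N|.
  by apply: cvg_norm; apply: cvgB => //; exact: cvg_cst.
rewrite -(cvg_lim _ cvgn1) //; apply: limr_le; first by apply/cvg_ex; eexists;
  exact: cvgn1.
by exists N => // M /= NM; exact: tail.
Qed.

End GeometricDecay.

Section XiStar.
Context {R : realType}.
Variables (f : {poly int}) (b : R[i] -> R[i]).
Hypothesis f_monic : f \is monic.
Hypothesis fb : partial_fractions f b.

Lemma fundamental_decay (A : pred R[i]) (s : nat -> int) :
  (forall z, z \in Omegas f_monic ->
     geometric_decay (fun n => cmod (fundamental_term A z (s n)))) ->
  geometric_decay (fun n => complex.Re (fundamental b f_monic A (s n))).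
Proof.
move=> As; apply: (@geometric_decay_le _ _
    (fun n => \sum_(z <- Omegas f_monic) cmod (b z) * cmod (fundamental_term A z
      (s n)))).
  move=> n; rewrite (le_trans (normr_Re _)) // (le_trans (cmod_sum _ _ _)) //.
  rewrite [leRHS]ger0_norm; last first.
    by apply: sumr_ge0 => z _; rewrite mulr_ge0 ?cmod_ge0.
  by apply: ler_sum => z _; rewrite cmodM.
by apply: geometric_decay_sum => z zO; apply: geometric_decayZ; exact: As.
Qed.

Lemma geometric_decay_eventually0 (a : nat -> R) N :
  (forall n, (N <= n)%N -> a n = 0) -> geometric_decay a.
Proof.
move=> a0; apply: (@geometric_decay_near _ _ N 0 (1 / 2)); [lra|lra|].
by move=> n /a0 ->; rewrite normr0 mul0r.
Qed.

(** At indices [n <= 0] only the roots outside the closed unit disc contribute.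
    *)
Lemma w_delta_minus_decay (k : int) :
  geometric_decay (fun n => w_delta_minus f b (k - n%:Z)).
Proof.
under [X in geometric_decay X]eq_fun do rewrite (w_delta_minusE b f_monic).
apply: fundamental_decay => z _; rewrite /fundamental_term.
case: lerP => z1.
  apply: (@geometric_decay_eventually0 _ `|k|%N) => n kn.
  have -> : (1 <= k - n%:Z) = false by lia.
  by rewrite cmod0.
have z0 : 0 < cmod z := lt_trans ltr01 z1.
apply: (@geometric_decay_near _ _ `|k|%N (cmod z ^ (k - 1)) (cmod z)^-1).
- by rewrite invr_gt0.
- by rewrite invf_lt1.
move=> n kn; have -> : (1 <= k - n%:Z) = false by lia.
rewrite cmodN ger0_norm ?cmod_ge0 // cmod_expz.
by rewrite addrAC expfzDr ?gt_eqF // exprVn -exprnN exprnP.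
Qed.

(** At indices [n >= 1] only the roots inside the open unit disc contribute. *)
Lemma w_delta_plus_decay (k : int) :
  geometric_decay (fun n => w_delta_plus f b (k + n%:Z)).
Proof.
under [X in geometric_decay X]eq_fun do rewrite (w_delta_plusE b f_monic).
apply: fundamental_decay => z _; rewrite /fundamental_term.
case: ltP => z1; last first.
  apply: (@geometric_decay_eventually0 _ `|k|.+1%N) => n kn.
  have -> : 1 <= k + n%:Z by lia.
  by rewrite cmod0.
(* a ratio strictly between 0 and 1, even if the root is 0 *)
pose r := (1 + cmod z) / 2.
have c0 := cmod_ge0 z.
have r0 : 0 < r by rewrite /r; lra.
have zr : cmod z <= r by rewrite /r; lra.
apply: (@geometric_decay_near _ _ `|k|.+1%N (r ^ (k - 1)) r) => //.
  by rewrite /r; lra.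
move=> n kn; have -> : 1 <= k + n%:Z by lia.
rewrite ger0_norm ?cmod_ge0 // cmod_expz.
have -> : k + n%:Z - 1 = `|(k + n%:Z - 1)%R|%N%:Z by lia.
apply: (@le_trans _ _ (r ^ `|(k + n%:Z - 1)%R|%N%:Z)).
  by rewrite -!exprnP lerXn2r ?nnegrE // ltW.
rewrite (_ : `|(k + n%:Z - 1)%R|%N%:Z = k - 1 + n%:Z); last lia.
by rewrite expfzDr ?gt_eqF // exprnP.
Qed.

(** The coefficients of the digits of nonnegative and of negative index in
    [xi_star]; the latter series starts at [1], whence the zero. *)
Definition past_kernel (k : int) (n : nat) : R := w_delta_minus f b (k - n%:Z).
Definition future_kernel (k : int) (n : nat) : R :=
  if n is 0%N then 0 else w_delta_plus f b (k + n%:Z).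

Lemma future_kernel_decay (k : int) : geometric_decay (future_kernel k).
Proof.
apply: geometric_decay_le (w_delta_plus_decay k) => -[|n] //=.
by rewrite normr0.
Qed.

Lemma xi_starE v (k : int) : xi_star f b v k =
  limn (pairing (fun n => v n%:Z) (past_kernel k)) +
  limn (pairing (fun n => v (- n%:Z)) (future_kernel k)).
Proof.
congr (_ + limn _); apply/funext => -[|N].
  by rewrite /pairing !big_geq.
rewrite /pairing [RHS]big_ltn //= mulr0 add0r.
by rewrite big_nat [RHS]big_nat; apply: eq_bigr => -[|n].
Qed.

Definition xi_trunc (v : zseq R) (k : int) N : R :=
  pairing (fun n => v n%:Z) (past_kernel k) N +
  pairing (fun n => v (- n%:Z)) (future_kernel k) N.

(** The convergence is uniform on bounded sets of [v]. *)
Lemma xi_trunc_cvg (k : int) : exists G r : R, [/\ 0 < r, r < 1 &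
  forall (v : zseq R) B, (forall n, `|v n| <= B) ->
    (xi_trunc v k @ \oo --> xi_star f b v k) /\
    forall N, `|xi_star f b v k - xi_trunc v k N| <= B * (G * r ^+ N)].
Proof.
have [G [r [r0 r1 Gr]]] := pairing_cvg (w_delta_minus_decay k).
have [G' [r' [r'0 r'1 Gr']]] := pairing_cvg (future_kernel_decay k).
exists (`|G| + `|G'|), (Num.max r r'); split; rewrite ?lt_max ?r0 ?gt_max ?r1
  //.
move=> v B vB; have B0 := le_trans (normr_ge0 _) (vB 0).
have [c1 e1] := Gr (fun n => v n%:Z) B (fun n => vB _).
have [c2 e2] := Gr' (fun n => v (- n%:Z)) B (fun n => vB _).
rewrite xi_starE; split=> [|N]; first exact: cvgD.
rewrite /xi_trunc opprD addrACA (le_trans (ler_normD _ _)) //.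
rewrite (le_trans (lerD (e1 N) (e2 N))) // -mulrDr ler_wpM2l // mulrDl lerD //.
  rewrite (le_trans (ler_wpM2r _ (ler_norm G))) ?exprn_ge0 ?(ltW r0) //
    ler_wpM2l //.
  by rewrite lerXn2r ?nnegrE ?(ltW r0) ?le_max ?lexx ?(ltW r0).
rewrite (le_trans (ler_wpM2r _ (ler_norm G'))) ?exprn_ge0 ?(ltW r'0) //
  ler_wpM2l //.
by rewrite lerXn2r ?nnegrE ?(ltW r'0) ?le_max ?lexx ?(ltW r'0) ?orbT.
Qed.

End XiStar.

(** * Words of the beta-shift *)

Lemma ptws_eval_continuous (I : choiceType) (T : topologicalType) (i : I) :
  continuous (fun u : {ptws I -> T} => (u : I -> T) i).
Proof. exact: (@proj_continuous I (fun=> T) i). Qed.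

Section BetaExpansions.
Context {R : realType}.
Variable beta : R.
Hypothesis beta_gt1 : 1 < beta.

Let beta_gt0 : 0 < beta. Proof. exact: lt_trans beta_gt1. Qed.

Lemma T_beta_itv x : 0 <= T_beta beta x < 1.
Proof.
rewrite /T_beta subr_ge0 floor_le /= ltrBlDl.
by have := floorD1_gt (beta * x); rewrite intrD.
Qed.

Lemma iter_T_beta_itv x n : 0 <= x < 1 -> 0 <= iter n (T_beta beta) x < 1.
Proof. by case: n => [//|n] _; rewrite iterS T_beta_itv. Qed.

Lemma e_betaE x n :
  e_beta beta x n = (Num.floor (beta * iter n (T_beta beta) x))%:~R.
Proof. by rewrite /e_beta iterS {2}/T_beta subKr. Qed.

Lemma e_betaS x n : e_beta beta x n.+1 = e_beta beta (T_beta beta x) n.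
Proof. by rewrite /e_beta -!iterSr. Qed.

Lemma e_beta_itv x n : 0 <= x < 1 -> 0 <= e_beta beta x n <= beta.
Proof.
move=> /(iter_T_beta_itv n) /andP[x0 x1].
rewrite e_betaE ler0z floor_ge0 mulr_ge0 ?(ltW beta_gt0) //=.
by rewrite (le_trans (floor_le _)) // ger_pMr // ltW.
Qed.

Definition word_value n x : R := \sum_(i < n) e_beta beta x i / beta ^+ i.

Lemma word_valueS n x : word_value n.+1 x =
  e_beta beta x 0 + word_value n (T_beta beta x) / beta.
Proof.
rewrite /word_value big_ord_recl expr0 divr1; congr (_ + _).
rewrite mulr_suml; apply: eq_bigr => i _.
by rewrite e_betaS exprSr invfM mulrA mulrAC.
Qed.

Lemma word_value_itv n x : 0 <= x < 1 -> 0 <= word_value n x <= beta * x.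
Proof.
elim: n x => [|n IHn] x x01.
  rewrite /word_value big_ord0 lexx mulr_ge0 ?(ltW beta_gt0) //.
  by case/andP: x01.
have /andP[w0 w1] := IHn _ (T_beta_itv x); have /andP[e0 _] := e_beta_itv 0 x01.
rewrite word_valueS addr_ge0 // ?divr_ge0 ?(ltW beta_gt0) //=.
have -> : beta * x = e_beta beta x 0 + T_beta beta x.
  by rewrite e_betaE /= /T_beta addrC subrK.
by rewrite lerD2l ler_pdivrMr // mulrC.
Qed.

(** Greedy expansions are determined by their values: the part of the value
    after the leading digit is less than [1], so that the leading digit is the
    integral part. *)
Lemma word_value_inj n x x' : 0 <= x < 1 -> 0 <= x' < 1 ->
  word_value n x = word_value n x' ->
  forall i, (i < n)%N -> e_beta beta x i = e_beta beta x' i.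
Proof.
elim: n x x' => // n IHn x x' x01 x'01; rewrite !word_valueS.
have tail z : 0 <= word_value n (T_beta beta z) / beta < 1.
  have /andP[w0 w1] := word_value_itv n (T_beta_itv z).
  rewrite divr_ge0 ?(ltW beta_gt0) //= ltr_pdivrMr // mul1r.
  by rewrite (le_lt_trans w1) // gtr_pMr //; case/andP: (T_beta_itv z).
move=> xx'; have e0 : e_beta beta x 0 = e_beta beta x' 0.
  move: xx' (tail x) (tail x'); rewrite !e_betaE.
  move: (word_value _ _ / _) (word_value _ _ / _) => p p' pp' p01 p'01.
  have flp (z : int) (r : R) : 0 <= r < 1 -> Num.floor (z%:~R + r) = z.
    by move=> /andP[r0 r1]; apply: floor_def; rewrite intrD; lra.
  by move: pp' => /(congr1 Num.floor); rewrite !flp // => ->.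
move=> [|i] /=; rewrite ?e0 // ltnS !e_betaS; apply: IHn;
  rewrite ?T_beta_itv //.
by move: xx'; rewrite e0 => /addrI; apply: mulIf; rewrite invr_eq0 gt_eqF.
Qed.

(** Multiplying the recurrence polynomial [f] by the polynomial with
    coefficients [y] and evaluating at the root [beta] gives zero; as [y]
    vanishes near both ends of the window, no boundary terms are left. *)
Lemma root_recurrence_sum (f : {poly int}) n (y : nat -> R) :
  root (map_poly intr f) beta ->
  (forall i, (i < (size f).-1)%N -> y i = 0) ->
  (forall i, (i < (size f).-1)%N -> y (n + i)%N = 0) ->
  \sum_(i < n) (\sum_(j < size f) (f`_j)%:~R * y (i + j)%N) / beta ^+ i = 0.
Proof.
move=> fb y0 yn; set m := (size f).-1 in y0 yn.
have b0 : beta != 0 by rewrite gt_eqF.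
under eq_bigr do rewrite mulr_suml.
rewrite exchange_big /=.
pose g k := y k / beta ^+ k.
pose S := \sum_(0 <= k < n + m) g k.
have inner (j : 'I_(size f)) :
    \sum_(i < n) (f`_j)%:~R * y (i + j)%N / beta ^+ i = (f`_j)%:~R * beta ^+ j *
      S.
  have jm : (j <= m)%N by rewrite -ltnS (ltn_predK (ltn_ord j)).
  have -> : S = \sum_(i < n) g (i + j)%N.
    have head0 : \sum_(0 <= k < j) g k = 0.
      rewrite big_nat big1 // => k /andP[_ kj].
      by rewrite /g y0 ?mul0r // (leq_trans kj).
    have tail0 : \sum_(n + j <= k < n + m) g k = 0.
      rewrite big_nat big1 // => k /andP[njk kn].
      have nk := leq_trans (leq_addr _ _) njk.
      by rewrite /g -(subnKC nk) yn ?mul0r // ltn_subLR.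
    rewrite /S (@big_cat_nat _ _ _ j) //=; last by rewrite (leq_trans jm) //
      leq_addl.
    rewrite head0 add0r (@big_cat_nat _ _ _ (n + j)) //=;
      [|by rewrite leq_addl|by rewrite leq_add2l].
    rewrite tail0 addr0.
    by rewrite -{1}[j : nat]add0n big_addn addnK big_mkord.
  rewrite mulr_sumr; apply: eq_bigr => i _; rewrite /g exprD.
  by field; rewrite !expf_neq0.
rewrite (eq_bigr _ (fun j _ => inner j)) -mulr_suml.
move: fb => /rootP; rewrite horner_coef size_map_inj_poly ?rmorph0 //;
  last exact: intr_inj.
under eq_bigr do rewrite coef_map /=.
by move=> ->; rewrite mul0r.
Qed.

Lemma beta_word_determined (f : {poly int}) n x x' (y : nat -> R) :
  root (map_poly intr f) beta -> 0 <= x < 1 -> 0 <= x' < 1 ->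
  (forall i, (i < n)%N -> e_beta beta x i - e_beta beta x' i =
    \sum_(j < size f) (f`_j)%:~R * y (i + j)%N) ->
  (forall i, (i < (size f).-1)%N -> y i = 0) ->
  (forall i, (i < (size f).-1)%N -> y (n + i)%N = 0) ->
  forall i, (i < n)%N -> e_beta beta x i = e_beta beta x' i.
Proof.
move=> fb x01 x'01 xy y0 yn; apply: word_value_inj => //.
apply/eqP; rewrite -subr_eq0 /word_value -sumrB; apply/eqP.
apply: etrans (root_recurrence_sum fb y0 yn); apply: eq_bigr => i _.
by rewrite -mulrBl xy.
Qed.

(** Digits are integers, so a point of the closure agrees on any finite window
    with an expansion that is close to it there. *)
Lemma V_beta_plus_word (u : nat -> R) n :
  V_beta_plus beta u -> (forall i, u i \is a Num.int) ->
  exists2 x, 0 <= x < 1 & forall i, (i < n)%N -> e_beta beta x i = u i.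
Proof.
move=> cu uint.
have close : \forall u' \near (u : {ptws nat -> R}),
    forall i : 'I_n, `|u i - (u' : nat -> R) i| < 1.
  apply: (@filter_forall _ _ _ _ (nbhs_filter (u : {ptws nat -> R}))) => i.
  have := @ptws_eval_continuous nat R i u.
  by move=> /(@cvgr_dist_lt R R)/(_ _ ltr01).
have [_ [[x x01 <-] xu]] := cu _ close.
exists x => // i ni; have := xu (Ordinal ni) => /=.
have /intrP[k ->] := uint i; rewrite e_betaE.
rewrite -intrB -intr_norm ltrz1 => ki; congr _%:~R; lia.
Qed.

Lemma V_beta_word (v : zseq R) (k : int) n : V_beta beta v ->
  exists2 x, 0 <= x < 1 & forall i, (i < n)%N -> e_beta beta x i = v (k + i%:Z).
Proof.
move=> [[_ vint] vV]; have := vV (k - 1); rewrite subrK => vk.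
by have := V_beta_plus_word n vk (fun i => vint _).
Qed.

Lemma V_beta_itv (v : zseq R) (k : int) : V_beta beta v -> 0 <= v k <= beta.
Proof.
move=> /(V_beta_word k 1)[x x01 /(_ 0%N isT)]; rewrite addr0 => <-.
exact: e_beta_itv.
Qed.

(** The difference of the two words is [f(sigma) y] with [y] vanishing at both
    ends, so the words have the same value in base [beta]; being greedy, they
    agree. *)
Lemma V_beta_window_eq (f : {poly int}) (v v' y : zseq R) n :
  root (map_poly intr f) beta -> V_beta beta v -> V_beta beta v' ->
  (forall i, (i < n)%N -> v i%:Z - v' i%:Z = poly_shift f y i%:Z) ->
  (forall i, (i < (size f).-1)%N -> y i%:Z = 0) ->
  (forall i, (i < (size f).-1)%N -> y (n + i)%N%:Z = 0) ->
  forall i, (i < n)%N -> v i%:Z = v' i%:Z.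
Proof.
move=> fb Vv Vv' vy y0 yn i ni.
have [x x01 xv] := V_beta_word 0 n Vv; have [x' x'01 xv'] := V_beta_word 0 n
  Vv'.
rewrite -[i%:Z]add0r -xv // -xv' //.
apply: (@beta_word_determined f n _ _ (fun i => y i%:Z) fb) => // k kn.
rewrite xv // xv' // !add0r vy // /poly_shift; apply: eq_bigr => j _.
by rewrite /zshift PoszD mulrC mulrzr.
Qed.

End BetaExpansions.

(** * The recurrence and the cocycle of xi_star *)

Section XiStarIdentities.
Context {R : realType}.
Variables (f : {poly int}) (b : R[i] -> R[i]).
Hypothesis f_monic : f \is monic.
Hypothesis fb : partial_fractions f b.

Lemma lim_pairing_recl (u a : nat -> R) B : geometric_decay a ->
  (forall n, `|u n| <= B) ->
  limn (pairing u a) =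
  u 0%N * a 0%N + limn (pairing (fun n => u n.+1) (fun n => a n.+1)).
Proof.
move=> da uB.
have da' : geometric_decay (fun n => a n.+1).
  have [G [r [r0 r1 ar]]] := da; exists (G * r), r; split=> // n.
  by rewrite -mulrA -exprS.
have [? [? [_ _ /(_ _ _ uB)[cu _]]]] := pairing_cvg da.
have [? [? [_ _ /(_ (fun n => u n.+1) B (fun n =>
  uB _))[cu' _]]]] := pairing_cvg da'.
apply/cvg_lim => //; rewrite -(cvg_shiftn 1) /=.
have -> : (fun n => pairing u a (n + 1)) =
    (fun n => u 0%N * a 0%N + pairing (fun n => u n.+1) (fun n => a n.+1) n).
  by apply/funext => n; rewrite addn1 /pairing big_nat_recl.
by apply: cvgD => //; exact: cvg_cst.
Qed.

(** By linearity, as [f(sigma)] maps both homoclinic points to [delta_0]; the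
    sums of the truncations are stationary once they contain the index [k]. *)
Lemma poly_shift_xi_star (v : zseq R) k : linfR v ->
  poly_shift f (xi_star f b v) k = v k.
Proof.
move=> /bounded_funP[B vB].
have cvl : poly_shift f (xi_trunc f b v ^~ N) k @[N --> \oo] -->
    poly_shift f (xi_star f b v) k.
  rewrite /poly_shift /zshift; apply: cvg_big => [|j _];
    first exact: add_continuous.
  have [? [? [_ _ /(_ _ _ vB)[+ _]]]] := xi_trunc_cvg b f_monic (k + j%:Z).
  rewrite -mulrzr (_ : (fun N => xi_trunc f b v (k + j%:Z) N *~ f`_j) =
    (fun N => xi_trunc f b v (k + j%:Z) N * (f`_j)%:~R)).
    exact: cvgMl.
  by apply/funext => N; rewrite mulrzr.
rewrite -(cvg_lim _ cvl) //; apply: lim_near_cst => //.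
exists `|k|%N.+1 => // N /= kN.
have -> : poly_shift f (xi_trunc f b v ^~ N) k =
  \sum_(0 <= n < N) v n%:Z * (k == n%:Z)%:R +
  \sum_(0 <= n < N) v (- n%:Z) * ((n != 0%N) && (k == - n%:Z))%:R.
  rewrite /poly_shift /zshift /xi_trunc.
  under eq_bigr do rewrite mulrzDl; rewrite big_split /=; congr (_ + _).
    rewrite /pairing; under eq_bigr do rewrite mulrz_suml.
    rewrite exchange_big /=; apply: eq_bigr => n _.
    rewrite -subr_eq0 -(poly_shift_w_delta_minus f_monic fb) mulr_sumr.
    by apply: eq_bigr => j _; rewrite mulrzAr /past_kernel /zshift addrAC.
  rewrite /pairing; under eq_bigr do rewrite mulrz_suml.
  rewrite exchange_big /=; apply: eq_bigr => -[|n] _.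
    by rewrite /= mulr0; apply: big1 => j _; rewrite mul0rz.
  rewrite /= -addr_eq0 -(poly_shift_w_delta_plus f_monic fb) mulr_sumr.
  by apply: eq_bigr => j _; rewrite mulrzAr /= /zshift addrAC.
have single (F : nat -> R) (p : nat) (e : nat -> bool) : (p < N)%N -> e p ->
    (forall n, e n -> n = p) -> \sum_(0 <= n < N) F n * (e n)%:R = F p.
  move=> pN ep eP; rewrite big_mkord (bigD1 (Ordinal pN)) //= ep mulr1.
  rewrite big1 ?addr0 // => n np; case en : (e n); rewrite ?mulr0 //.
  by move: np; rewrite -val_eqE /= (eP _ en) eqxx.
case: (lerP 0 k) => k0.
  rewrite (single (fun n => v n%:Z) `|k|%N) ?gez0_abs ?eqxx //;
    last by move=> n /eqP ->.
  by rewrite big1 ?addr0 // => n _; case: andP => [[n0 /eqP kn]|];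
    [lia|rewrite mulr0].
rewrite big1 ?add0r; last by move=> n _; case: eqP => [kn|];
  [lia|rewrite mulr0].
rewrite (single (fun n => v (- n%:Z)) `|k|%N) //; first by congr v; lia.
  by apply/andP; split; [lia|apply/eqP; lia].
by move=> n /andP[_ /eqP ->]; lia.
Qed.

(** Passing from [v] to its shift moves the single digit [v 0] from the past
    kernel to the future kernel. *)
Lemma cocycle1E (v : zseq R) k : linfR v ->
  cocycle f b 1 v k = v 0 * w_delta_zero f b (k + 1).
Proof.
move=> /bounded_funP[B vB]; rewrite /cocycle /zshift !xi_starE.
rewrite (lim_pairing_recl (w_delta_minus_decay b f_monic (k + 1)) (B := B)) //.
rewrite (lim_pairing_recl (future_kernel_decay b f_monic (k + 1)) (B := B)) //.
rewrite (lim_pairing_recl (future_kernel_decay b f_monic k) (B := B)) //= !mulr0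
  !add0r.
have da : geometric_decay (fun n => w_delta_plus f b (k + n.+1%:Z)).
  have [G [r [r0 r1 ar]]] := w_delta_plus_decay b f_monic k.
  by exists (G * r), r; split=> // n; rewrite -mulrA -exprS.
rewrite [in X in _ - (_ + X)](lim_pairing_recl da (B := B)) //.
rewrite (_ : (fun n => v n.+1%:Z) = (fun n => v (n%:Z + 1))); last first.
  by apply/funext => n; congr v; lia.
rewrite (_ : (fun n => w_delta_minus f b (k + 1 - n.+1%:Z)) = past_kernel f b
  k); last first.
  by apply/funext => n; congr w_delta_minus; lia.
rewrite (_ : (fun n => v (- n.+2%:Z + 1)) = (fun n => v (- n.+1%:Z)));
  last first.
  by apply/funext => n; congr v; lia.
rewrite (_ : (fun n => w_delta_plus f b (k + n.+2%:Z)) = (fun n =>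
  w_delta_plus f b (k + 1 + n.+1%:Z))); last first.
  by apply/funext => n; congr w_delta_plus; lia.
rewrite subr0 (_ : - 1%:Z + 1 = 0) //.
by rewrite /w_delta_zero mulrBr; lra.
Qed.

End XiStarIdentities.

(** * The torus and the dynamics on the extended beta-shift *)

Section Torus.
Context {R : realType}.
Definition torus_pi (x : R) : torus R := (\pi_(torus R) x)%qT.

Lemma torus_pi_eq (x y : R) : torus_pi x = torus_pi y <-> x - y \is a Num.int.
Proof. 
have h : ((\pi_(R_mod_Z R) x)%qT == (\pi_(R_mod_Z R) y)%qT) = (x - y \is a
  Num.int).
  by rewrite -Quotient.idealrBE.
rewrite -h; split=> [xy|xy]; [by apply/eqP|by move: xy => /eqP].
Qed.

Lemma torus_piB : zmod_morphism torus_pi.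
Proof.
move=> x y. 
have h : (\pi_(R_mod_Z R) (x - y))%qT = (\pi_(R_mod_Z R) x)%qT - (\pi_(R_mod_Z
  R) y)%qT :> R_mod_Z R.
  by rewrite Quotient.pi_add Quotient.pi_opp.
exact: h.
Qed.
HB.instance Definition _ := GRing.isZmodMorphism.Build R (torus R) torus_pi
  torus_piB.

Lemma torus_pi_eq0 (x : R) : x \is a Num.int -> torus_pi x = 0.
Proof.
by move=> xint; rewrite -[RHS](raddf0 torus_pi); apply/torus_pi_eq;
  rewrite subr0.
Qed.
Lemma torus_pi_continuous : continuous torus_pi.
Proof. exact: pi_continuous. Qed.
Lemma repr_torus_pi (x : R) : x - repr (torus_pi x) \is a Num.int.
Proof. by apply/torus_pi_eq; rewrite /torus_pi reprK. Qed.
Lemma rhoE (y : zseq R) n : rho y n = torus_pi (y n). Proof. by []. Qed.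
End Torus.

Section CoordinatewiseConvergence.
Context {R : realType}.

Lemma cvg_set_type (T : topologicalType) (A : set T) Z (F : set_system Z)
    (FF : Filter F) (g : Z -> set_type A) (x : set_type A) :
  val (g z) @[z --> F] --> val x -> g @ F --> x.
Proof.
move=> gx U [_ [[W oW <-] Wx] WU]; apply: filterS WU _.
by apply: gx; exact: open_nbhs_nbhs.
Qed.

Lemma cvg_ptws (I : Type) (T : topologicalType) Z (F : set_system Z)
    (FF : Filter F) (g : Z -> {ptws I -> T}) (u : {ptws I -> T}) :
  (forall i, (g z : I -> T) i @[z --> F] --> (u : I -> T) i) -> g @ F --> u.
Proof.
move=> gu; apply/cvg_sup => i U [_ [[W oW <-] Wx] WU]; apply: filterS WU _.
by apply: (gu i); exact: open_nbhs_nbhs.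
Qed.

Variables (beta : R) (f : {poly int}).
Local Notation Y := (Ytilde_beta beta f).

Lemma cvg_Ytilde Z (F : set_system Z) (FF : Filter F) (g : Z -> Y) (y : Y) :
  (forall k, (val (g z)).1 k @[z --> F] --> (val y).1 k) ->
  (forall k, (val (g z)).2 k @[z --> F] --> (val y).2 k) ->
  g @ F --> y.
Proof.
move=> gv gw; apply: cvg_set_type.
rewrite [val y]surjective_pairing.
under [X in X @ _ --> _]eq_fun do rewrite [val _]surjective_pairing.
exact: (cvg_pair (cvg_ptws FF gv) (cvg_ptws FF gw)).
Qed.

Lemma cvg_X Z (F : set_system Z) (FF : Filter F) (g : Z ->
  @X R f) (x : @X R f) :
  (forall k, (val (g z) : int -> torus R) k @[z --> F] --> (val x : int ->
    torus R) k) ->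
  g @ F --> x.
Proof. by move=> gx; apply: cvg_set_type; apply: cvg_ptws. Qed.

Lemma val_Ytilde_continuous : continuous (fun y : Y => val y).
Proof. exact: initial_continuous. Qed.

Lemma digit_continuous k : continuous (fun y : Y => (val y).1 k : R).
Proof.
move=> y; apply: (@continuous_comp _ _ _ (fun y : Y =>
  (val y).1) (fun v : zseq R => v k)).
  by apply: continuous_comp; [exact: val_Ytilde_continuous|exact: cvg_fst].
exact: ptws_eval_continuous.
Qed.

Lemma fibre_continuous k : continuous (fun y : Y => (val y).2 k : R).
Proof.
move=> y; apply: (@continuous_comp _ _ _ (fun y : Y =>
  (val y).2) (fun v : zseq R => v k)).
  by apply: continuous_comp; [exact: val_Ytilde_continuous|exact: cvg_snd].
exact: ptws_eval_continuous.
Qed.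

Lemma X_coord_continuous k : continuous (fun x : @X R f =>
  (val x : int -> torus R) k).
Proof.
move=> x; apply: (@continuous_comp _ _ _ (fun x : @X R f => val x)
   (fun v : {ptws int -> torus R} => (v : int -> torus R) k)).
  exact: initial_continuous.
exact: ptws_eval_continuous.
Qed.

Lemma YtildeP (y : Y) : V_beta beta (val y).1 /\ W0 f (val y).2.
Proof. by have /set_mem[] := valP y. Qed.

Lemma digit_int (y : Y) k : (val y).1 k \is a Num.int.
Proof. by have [[[_]]] := YtildeP y. Qed.

End CoordinatewiseConvergence.

Section Dynamics.
Context {R : realType}.
Variables (beta : R) (f : {poly int}) (b : R[i] -> R[i]).
Hypothesis beta_gt1 : 1 < beta.
Hypothesis f_monic : f \is monic.
Hypothesis fb : partial_fractions f b.
Local Notation Y := (Ytilde_beta beta f).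
Local Notation sigma := (sigma_tilde_beta b : Y -> Y).

Lemma digit_le (y : Y) k : `|(val y).1 k| <= beta.
Proof.
have [Vy _] := YtildeP y; have /andP[d0 d1] := V_beta_itv beta_gt1 k Vy.
by rewrite ger0_norm.
Qed.

Lemma linfR_digit (y : Y) : linfR (val y).1.
Proof. by apply/bounded_funP; exists beta => k; exact: digit_le. Qed.

Lemma val_sigma_tilde (y : Y) : val (sigma y) = sigma_tilde f b (val y).
Proof.
rewrite /sigma_tilde_beta insubdK //; apply/mem_set; split=> /=.
  have [[[bv iv] Vv] _] := YtildeP y; split; first split.
  - apply/bounded_funP; exists beta => k; exact: digit_le.
  - by move=> n; exact: iv.
  - move=> n; have := Vv (n + 1); congr V_beta_plus.
    by apply/funext => k; rewrite /zshift; congr (_ _); lia.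
have [_ [/bounded_funP[B wB] fw]] := YtildeP y.
have [/bounded_funP[B0 w0B] fw0] := w_delta_zero_W0 f_monic fb.
have E k : zshift 1 (val y).2 k + cocycle f b 1 (val y).1 k =
    (val y).2 (k + 1) - - (val y).1 0 * w_delta_zero f b (k + 1).
  by rewrite (cocycle1E b f_monic) ?mulNr ?opprK //; exact: linfR_digit.
split.
  apply/bounded_funP; exists (B + `|(val y).1 0| * B0) => k.
  rewrite E (le_trans (ler_normB _ _)) // lerD // normrM normrN.
  by rewrite ler_wpM2l.
move=> n; rewrite (_ : (fun k => _ + _) = fun k =>
  (val y).2 (k + 1) - - (val y).1 0 * w_delta_zero f b (k + 1));
  last exact/funext/E.
rewrite poly_shiftB (poly_shift_translate f (val y).2) fw sub0r.
rewrite /poly_shift /zshift; apply/eqP; rewrite oppr_eq0; apply/eqP.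
under eq_bigr do rewrite -mulrzAr.
rewrite -mulr_sumr -[RHS](mulr0 (- (val y).1 0)); congr (_ * _).
rewrite -[RHS](fw0 (n + 1)); apply: eq_bigr => j _; rewrite /zshift.
by rewrite addrAC.
Qed.

Lemma digit_iter (y : Y) t k : (val (iter t sigma y)).1 k = (val y).1 (k +
  t%:Z).
Proof.
elim: t k => [|t IHt] k; first by rewrite addr0.
by rewrite iterS val_sigma_tilde /= /zshift IHt; congr (_ _); lia.
Qed.

(** Explicit form of the skew product: the fibre coordinate is translated by an
    amount which depends on the digits read so far. *)
Lemma fibre_iter (y : Y) t k : (val (iter t sigma y)).2 k =
  (val y).2 (k + t%:Z) +
  \sum_(i < t) (val y).1 i%:Z * w_delta_zero f b (k + t%:Z - i%:Z).
Proof.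
elim: t k => [|t IHt] k; first by rewrite addr0 big_ord0 addr0.
rewrite iterS val_sigma_tilde /= (cocycle1E b f_monic); last exact: linfR_digit.
rewrite /zshift IHt digit_iter add0r big_ord_recr /= -addrA;
  congr (_ + (_ + _)).
- by congr (_ _); lia.
- by apply: eq_bigr => i _; congr (_ * w_delta_zero _ _ _); lia.
- by congr (_ * w_delta_zero _ _ _); lia.
Qed.

Definition lift (y : Y) (k : int) : R := xi_star f b (val y).1 k + (val y).2 k.

Lemma lift_sigma (y : Y) k : lift (sigma y) k = lift y (k + 1).
Proof.
rewrite /lift val_sigma_tilde /= /cocycle /zshift.
by ring.
Qed.

Lemma lift_iter (y : Y) t k : lift (iter t sigma y) k = lift y (k + t%:Z).
Proof.
elim: t k => [|t IHt] k; first by rewrite addr0.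
by rewrite iterS lift_sigma IHt; congr (lift y _); lia.
Qed.

Lemma poly_shift_lift (y : Y) k : poly_shift f (lift y) k = (val y).1 k.
Proof.
have [_ [_ fw]] := YtildeP y.
rewrite -(poly_shift_xi_star f_monic fb k (linfR_digit y)) -[RHS]addr0 -(fw k).
rewrite -big_split; apply: eq_bigr => j _ /=.
by rewrite -mulrzDl.
Qed.

Lemma val_xi_tilde (y : Y) : val (xi_tilde b y) = rho (lift y).
Proof.
rewrite /xi_tilde insubdK //; apply/mem_set => k.
rewrite -(torus_pi_eq0 (digit_int y k)) -poly_shift_lift raddf_sum.
by apply: eq_bigr => j _; rewrite /zshift rhoE raddfMz.
Qed.

(** A uniform limit of finite sums of digits. *)
Lemma xi_star_continuous k : continuous (fun y : Y => xi_star f b (val y).1 k).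
Proof.
have [G [r [r0 r1 Gr]]] := xi_trunc_cvg b f_monic k.
have Yr (y : Y) N := (Gr (val y).1 beta (digit_le y)).2 N.
move=> y; have FF : Filter (nbhs y) := nbhs_filter y.
apply/(@cvgrPdist_lt R R _ _ FF) => e e0.
have beta0 : 0 < beta := lt_trans ltr01 beta_gt1.
have [N Ne] : exists N, beta * (G * r ^+ N) < e / 3.
  have : (fun N => beta * (G * r ^+ N)) @ \oo --> beta * (G * 0).
    by apply: cvgMr; apply: cvgMr; apply: cvg_expr; rewrite ger0_norm ?(ltW r0).
  rewrite !mulr0 => /cvgr_lt/(_ (e / 3)) [|N _ /(_ N (leqnn N))];
    last by exists N.
  by rewrite divr_gt0.
have trunc_cont : {for y, continuous (fun y : Y => xi_trunc f b (val y).1 k N)}.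
  by apply: cvgD; rewrite /pairing; (apply: cvg_big => [|n _];
    first exact: add_continuous); apply: cvgMl; exact: digit_continuous.
have e3 : 0 < e / 3 by rewrite divr_gt0.
move: trunc_cont => /(@cvgrPdist_lt R R _ _ FF)/(_ _ e3).
apply: filterS => y' yy'.
have h1 := le_lt_trans (Yr y N) Ne.
have h2 := le_lt_trans (Yr y' N) Ne.
rewrite distrC in h2.
have -> : xi_star f b (val y).1 k - xi_star f b (val y').1 k =
  (xi_star f b (val y).1 k - xi_trunc f b (val y).1 k N) +
  ((xi_trunc f b (val y).1 k N - xi_trunc f b (val y').1 k N) +
   (xi_trunc f b (val y').1 k N - xi_star f b (val y').1 k)) by ring.
rewrite (le_lt_trans (ler_normD _ _)) // (le_lt_trans (lerD (lexx _) (ler_normD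
  _ _))) //.
move: yy' h1 h2 => /=; lra.
Qed.

Lemma lift_continuous k : continuous (fun y : Y => lift y k).
Proof.
move=> y; exact: (cvgD (@xi_star_continuous k y) (@fibre_continuous _ _ _ k y)).
Qed.

Lemma sigma_tilde_continuous : continuous sigma.
Proof.
move=> y; apply: (@cvg_Ytilde _ _ _ _ (nbhs y) (nbhs_filter y)) => k.
  under [X in X @ _ --> _]eq_fun do rewrite val_sigma_tilde /=.
  by rewrite val_sigma_tilde; exact: digit_continuous.
rewrite val_sigma_tilde /= (cocycle1E b f_monic) //; last exact: linfR_digit.
rewrite (_ : (fun z : Y => _) = fun z : Y => (val z).2 (k + 1) + (val z).1 0 *
  w_delta_zero f b (k + 1)).
  by apply: cvgD; [exact: fibre_continuous|apply: cvgMl;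
    exact: digit_continuous].
apply/funext => z; rewrite val_sigma_tilde /= (cocycle1E b f_monic) //.
exact: linfR_digit.
Qed.

Lemma xi_tilde_continuous : continuous (xi_tilde b : Y -> X f).
Proof.
move=> y; apply: (@cvg_X _ _ _ (nbhs y) (nbhs_filter y)) => k.
under [X in X @ _ --> _]eq_fun do rewrite val_xi_tilde.
rewrite val_xi_tilde /rho.
apply: (@continuous_comp _ _ _ (fun y : Y => lift y k) torus_pi).
  exact: lift_continuous.
exact: torus_pi_continuous.
Qed.

Lemma xi_tilde_sigma (y : Y) : xi_tilde b (sigma y) = alpha (xi_tilde b y).
Proof.
apply: val_inj; rewrite val_xi_tilde /= val_xi_tilde.
by apply/funext => k; rewrite /rho /zshift lift_sigma.
Qed.

End Dynamics.

(** * Borel sets and the theorem of Lusin *)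

Section BorelMeasurability.

Lemma open_borel (T : ptopologicalType) (A : set T) :
  open A -> measurable (A : set (borel T)).
Proof. by move=> oA; exact: sub_sigma_algebra. Qed.

Lemma continuous_borel (T U : ptopologicalType) (g : T -> U) :
  continuous g -> measurable_fun setT (g : borel T -> borel U).
Proof.
move=> /continuousP cg; apply: (@measurability _ _ (borel T) (borel U) setT g
  (@open U)) => // _ [V oV <-].
by rewrite setTI; apply: open_borel; exact: cg.
Qed.

Lemma vanishing_measure {d} {T : measurableType d} {R : realType}
    (mu : probability T R) (F : nat -> set T) (e : R) : 0 < e ->
  (forall n, measurable (F n)) -> (forall n m, (n <= m)%N -> F m `<=` F n) ->
  \bigcap_n F n = set0 -> exists n, (mu (F n) <= e%:E)%E.
Proof.
move=> e0 mF niF F0.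
have : mu \o F @ \oo --> mu (\bigcap_n F n).
  apply: nonincreasing_cvg_mu => //.
  - by rewrite (le_lt_trans (probability_le1 _ _)) // ltry.
  - by rewrite F0.
  - by move=> n m nm; rewrite subsetEset; exact: niF.
rewrite F0 measure0 => /fine_cvgP[_] /cvgrPdist_le/(_ _ e0)[N _ /(_ N (leqnn
  N))] /=.
rewrite sub0r normrN => FN; exists N.
rewrite -[mu (F N)]fineK ?fin_num_measure // lee_fin (le_trans (ler_norm _)) //.
Qed.

End BorelMeasurability.

Section Closeness.
Context {R : realType}.
Variables (beta : R) (f : {poly int}).
Local Notation Y := (Ytilde_beta beta f).
Local Notation BY := (borel Y).
Implicit Types (y : Y) (N : nat).

(** These entourages generate the topology of the extended beta-shift. *)
Definition close N y y' := forall k : int, (`|k| <= N)%N ->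
  (val y).1 k = (val y').1 k /\ `|(val y).2 k - (val y').2 k| < N.+1%:R^-1.

Lemma close_sym N y y' : close N y y' -> close N y' y.
Proof.
by move=> yy' k /yy'[-> wk]; split=> //; rewrite distrC.
Qed.

Lemma close_le N M y y' : (N <= M)%N -> close M y y' -> close N y y'.
Proof.
move=> NM yy' k kN; have [-> wk] := yy' k (leq_trans kN NM); split=> //.
by rewrite (lt_le_trans wk) // lef_pV2 ?posrE // ler_nat.
Qed.

Lemma open_close N y' : open [set y | close N y y'].
Proof.
rewrite openE => y /= yy'.
have FF : Filter (nbhs y) := nbhs_filter y.
have near1 (k : int) : (`|k| <= N)%N -> \forall z \near y,
    (val z).1 k = (val y').1 k /\ `|(val z).2 k - (val y').2 k| < N.+1%:R^-1.
  move=> kN; have [vk wk] := yy' k kN; apply: filterI.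
    have := @digit_continuous _ beta f k y => /(@cvgrPdist_lt R R _ _ FF)/(_ _
      ltr01).
    apply: filterS => z; rewrite -vk => {}wk.
    move: wk (digit_int y k) (digit_int z k).
    move=> + /intrP[a aE] /intrP[c cE]; rewrite aE cE.
    by rewrite -intrB -intr_norm ltrz1 => ac; congr _%:~R; lia.
  have := @fibre_continuous _ beta f k y => /(@cvgrPdist_lt R R _ _ FF).
  move=> /(_ (N.+1%:R^-1 - `|(val y).2 k - (val y').2 k|));
    rewrite subr_gt0 => /(_ wk).
  apply: filterS => z zy; rewrite -(subrK ((val y).2 k) ((val z).2 k)) -addrA.
  by rewrite (le_lt_trans (ler_normD _ _)) // -ltrBrDr distrC.
have H : \forall z \near y, forall i : 'I_(N.*2.+1),
    (val z).1 (i%:Z - N%:Z) = (val y').1 (i%:Z - N%:Z) /\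
    `|(val z).2 (i%:Z - N%:Z) - (val y').2 (i%:Z - N%:Z)| < N.+1%:R^-1.
  apply: (@filter_forall _ _ _ _ FF) => i; apply: near1.
  by have := ltn_ord i; lia.
apply: filterS H => z zy' k kN.
have iN : (`|(k + N%:Z)%R|%N < N.*2.+1)%N by lia.
have := zy' (Ordinal iN) => /=.
by rewrite (_ : `|(k + N%:Z)%R|%N%:Z - N%:Z = k) //; lia.
Qed.

Lemma open_close_sub (A : set Y) y : open A -> A y ->
  exists N, forall y', close N y' y -> A y'.
Proof.
move=> oA Ay; apply: contrapT => noN.
have bad N : exists y', close N y' y /\ ~ A y'.
  apply: contrapT => nobad; apply: noN; exists N => y' y'y.
  by apply: contrapT => nAy'; apply: nobad; exists y'.
pose u N := projT1 (cid (bad N)).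
have uy N : close N (u N) y by rewrite /u; case: cid => ? [].
have uA N : ~ A (u N) by rewrite /u; case: cid => ? [].
have cu : u @ \oo --> y.
  apply: cvg_Ytilde => k.
    apply/cvgrPdist_lt => e e0; exists `|k|%N => // N /= kN.
    by have [-> _] := uy N k kN; rewrite subrr normr0.
  apply/cvgrPdist_lt => e e0; near=> N.
  have kN : (`|k| <= N)%N by near: N; exists `|k|%N.
  have [_] := uy N k kN; rewrite distrC => /lt_trans; apply.
  by near: N; exact: near_infty_natSinv_lt (PosNum e0).
have /cu [N _ /(_ N (leqnn N))] : nbhs y A by exact: open_nbhs_nbhs.
exact: uA.
Unshelve. all: by end_near. Qed.

End Closeness.

Section Lusin.
Context {R : realType}.
Variables (beta : R) (f : {poly int}).
Local Notation Y := (Ytilde_beta beta f).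
Local Notation BY := (borel Y).
Variable mu : probability BY R.

(** Off a small event, membership in [A] is decided at some finite scale; one
    implication suffices as closeness is symmetric. *)
Definition lusin_set (A : set BY) := measurable A /\
  forall e : R, 0 < e -> exists N (S : set BY), [/\
    measurable S, (mu (~` S) <= e%:E)%E &
    forall y y', S y -> S y' -> close N y y' -> A y -> A y'].

Lemma lusin_setC (A : set BY) : lusin_set A -> lusin_set (~` A).
Proof.
move=> [mA lA]; split=> [|e e0]; first exact: measurableC.
have [N [S [mS muS SA]]] := lA e e0; exists N, S; split=> //.
by move=> y y' Sy Sy' /close_sym yy' nAy Ay'; apply: nAy; exact: SA Ay'.
Qed.

Lemma measure_setCI (S S' : set BY) (e e' : R) : measurable S ->
  measurable S' ->
  (mu (~` S) <= e%:E)%E -> (mu (~` S') <= e'%:E)%E ->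
  (mu (~` (S `&` S')) <= (e + e')%:E)%E.
Proof.
move=> mS mS' Se Se'; rewrite setCI EFinD.
by rewrite (le_trans (measureU2 _ _ _)) ?leeD //; exact: measurableC.
Qed.

Lemma lusin_setU (A B : set BY) : lusin_set A -> lusin_set B ->
  lusin_set (A `|` B).
Proof.
move=> [mA lA] [mB lB]; split=> [|e e0]; first exact: measurableU.
have e2 : 0 < e / 2 by rewrite divr_gt0.
have [N [S [mS muS SA]]] := lA _ e2; have [M [S' [mS' muS' SB]]] := lB _ e2.
exists (maxn N M), (S `&` S'); split; first exact: measurableI.
  by rewrite [X in (_ <= X%:E)%E](splitr e); exact: measure_setCI.
move=> y y' [Sy S'y] [Sy' S'y'] yy' [Ay|By]; [left|right].
  by apply: SA Sy Sy' (close_le _ yy') Ay; exact: leq_maxl.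
by apply: SB S'y S'y' (close_le _ yy') By; exact: leq_maxr.
Qed.

Lemma lusin_set0 : lusin_set set0.
Proof.
split=> // e e0; exists 0%N, setT; split=> //.
by rewrite setCT measure0 lee_fin ltW.
Qed.

(** The points of [A] outside a late [F n] form a small event, which can be
    discarded. *)
Lemma lusin_exhaustion (A : set BY) (F : nat -> set BY) : measurable A ->
  (forall n, measurable (F n)) -> (forall n m, (n <= m)%N -> F n `<=` F m) ->
  A = \bigcup_n F n ->
  (forall n e, 0 < e -> exists N (S : set BY), [/\
    measurable S, (mu (~` S) <= e%:E)%E &
    forall y y', S y -> S y' -> close N y y' -> F n y -> A y']) -> lusin_set A.
Proof.
move=> mA mF ndF AF lF; split=> // e e0.
have e2 : 0 < e / 2 by rewrite divr_gt0.
have [n muAF] : exists n, (mu (A `\` F n) <= (e / 2)%:E)%E.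
  apply: vanishing_measure => //.
  - by move=> n; exact: measurableD.
  - by move=> n m nm y [Ay nFy]; split=> // Fy; apply: nFy; exact: ndF Fy.
  - apply/seteqP; split=> // y yAF; have [+ _] := yAF 0%N I.
    by rewrite AF => -[n _ Fy]; have [] := yAF n I.
have [N [S [mS muS SF]]] := lF n _ e2.
have mAF : measurable (~` (A `\` F n)) by apply: measurableC;
  exact: measurableD.
exists N, (S `&` ~` (A `\` F n)); split; first exact: measurableI.
  by rewrite [X in (_ <= X%:E)%E](splitr e); apply: measure_setCI;
    rewrite ?setCK.
move=> y y' [Sy nAFy] [Sy' _] yy' Ay; apply: SF Sy Sy' yy' _.
by apply: contrapT => nFy; apply: nAFy.
Qed.

Lemma lusin_bigcup (A : nat -> set BY) : (forall n, lusin_set (A n)) ->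
  lusin_set (\bigcup_n A n).
Proof.
move=> lA; pose F n := \big[setU/set0]_(i < n) A i.
have lF n : lusin_set (F n).
  by rewrite /F; elim/big_ind : _ => [|B C|i _];
    [exact: lusin_set0|exact: lusin_setU|exact: lA].
have FA n : F n `<=` \bigcup_n A n.
  by rewrite /F -bigcup_mkord => y [i _ Ay]; exists i.
apply: (@lusin_exhaustion _ F).
- by apply: bigcup_measurable => n _; case: (lA n).
- by move=> n; case: (lF n).
- by move=> n m nm; rewrite /F -!bigcup_mkord => y [i /= ni Ay];
  exists i => //=; exact: leq_trans nm.
- apply/seteqP; split=> y [n _]; last exact: FA.
  by move=> Ay; exists n.+1 => //; rewrite /F -bigcup_mkord; exists n => /=.
- move=> n e e0; have [_ /(_ e e0)[N [S [mS muS SF]]]] := lF n.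
  exists N, S; split=> // y y' Sy Sy' yy' Fy; apply: (FA n).
  exact: SF Fy.
Qed.

(** The points of an open set which are interior at scale [N] exhaust it; no
    exception has to be made for them. *)
Lemma lusin_open (A : set Y) : open A -> lusin_set A.
Proof.
move=> oA; pose F N := [set y | forall y', close N y' y -> A y'].
apply: (@lusin_exhaustion _ F).
- exact: open_borel.
- move=> N; rewrite -[F N]setCK; apply: measurableC; apply: open_borel.
  have -> : ~` F N = \bigcup_(y' in ~` A) [set y | close N y y'].
    apply/seteqP; split=> [y nFy|y [y' nAy' yy'] Fy].
      apply: contrapT => ny; apply: nFy => y' y'y; apply: contrapT => nAy'.
      by apply: ny; exists y' => //; exact: close_sym.
    by apply: nAy'; apply: Fy; exact: close_sym.
  by apply: bigcup_open => y' _; exact: open_close.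
- by move=> n m nm y Fy y' y'y; apply: Fy; exact: close_le y'y.
- apply/seteqP; split=> [y Ay|y [n _ Fy]].
    by have [N NA] := open_close_sub oA Ay; exists N.
  by apply: Fy => k _; rewrite subrr normr0 invr_gt0.
- move=> N e e0; exists N, setT; split=> //.
    by rewrite setCT measure0 lee_fin ltW.
  by move=> y y' _ _ /close_sym yy' Fy; exact: Fy.
Qed.

(** The sets with this property form a sigma-algebra. *)
Lemma lusin_measurable (A : set BY) : measurable A -> lusin_set A.
Proof.
apply: smallest_sub; last exact: lusin_open.
split; [exact: lusin_set0| |exact: lusin_bigcup].
by move=> B lB; rewrite setTD; exact: lusin_setC.
Qed.

(** Lusin's theorem for finite valued functions. *)
Lemma lusin_label (I : finType) (g : BY -> I) (e : R) : measurable_label g ->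
  0 < e ->
  exists N (S : set BY), [/\ measurable S, (mu (~` S) <= e%:E)%E &
    forall y y', S y -> S y' -> close N y y' -> g y = g y'].
Proof.
move=> mg e0.
suff [N [S [mS muS Sg]]] : exists N (S : set BY), [/\
  measurable S, (mu (~` S) <= e%:E)%E &
    forall i, i \in enum I -> forall y y', S y -> S y' -> close N y y' ->
      g y = i -> g y' = i].
  exists N, S; split=> // y y' Sy Sy' yy'.
  have gI : g y \in enum I by rewrite mem_enum.
  by rewrite (Sg _ gI y y' Sy Sy' yy' erefl).
elim: (enum I) e e0 => [|i s IHs] e e0.
  by exists 0%N, setT; split=> //; rewrite setCT measure0 lee_fin ltW.
have e2 : 0 < e / 2 by rewrite divr_gt0.
have [N [S [mS muS Sg]]] := IHs _ e2.
have [_ /(_ _ e2)[M [S' [mS' muS' S'g]]]] := lusin_measurable (mg i).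
exists (maxn N M), (S `&` S'); split; first exact: measurableI.
  by rewrite [X in (_ <= X%:E)%E](splitr e); exact: measure_setCI.
move=> j; rewrite inE => /orP[/eqP ->|js] y y' [Sy S'y] [Sy' S'y'] yy'.
  by apply: S'g => //; apply: close_le yy'; exact: leq_maxr.
by apply: Sg => //; apply: close_le yy'; exact: leq_maxl.
Qed.

End Lusin.

(** * Carries *)

Section FractionalPart.
Context {R : realType}.

Definition torus_frac (t : torus R) : R := repr t - (Num.floor (repr t))%:~R.

Lemma torus_frac_pi (x : R) : torus_frac (torus_pi x) = x - (Num.floor x)%:~R.
Proof.
rewrite /torus_frac; have /intrP[m xm] := repr_torus_pi x.
move: (repr _) xm => r /eqP; rewrite subr_eq => /eqP ->.
by rewrite floorDzr ?intr_int // intrKfloor intrD; ring.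
Qed.

Lemma torus_frac_itv t : 0 <= torus_frac t < 1.
Proof.
rewrite /torus_frac subr_ge0 floor_le /= ltrBlDl.
by have := floorD1_gt (repr t); rewrite intrD.
Qed.

(** The fractional part jumps down when crossing [0], and the set where it
    exceeds a given [a >= 0] is open. *)
Lemma measurable_torus_frac (T : ptopologicalType) (h : T -> torus R) :
  continuous h -> measurable_fun setT (torus_frac \o h : borel T -> R).
Proof.
move=> ch; apply: (measurability _ (measurable_realfun.RGenOInfty.measurableE
  R)) => _ [_ [a ->] <-].
rewrite setTI; apply: open_borel.
have -> : (torus_frac \o h) @^-1` `]a, +oo[ = h @^-1` [set t | a < torus_frac
  t].
  by apply/seteqP; split=> y /=; rewrite in_itv /= andbT.
suff oa : open [set t | a < torus_frac t] by move: ch => /continuousP; exact.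
have [a0|a0] := ltrP a 0.
  rewrite (_ : [set _ | _] = setT); first exact: openT.
  by apply/seteqP; split=> // t _ /=; case/andP: (torus_frac_itv t) =>
    /(lt_le_trans a0).
suff : open (torus_pi @^-1` [set t | a < torus_frac t]) by [].
have -> : torus_pi @^-1` [set t | a < torus_frac t] =
    \bigcup_(n in [set: int]) `]n%:~R + a, n%:~R + 1[%classic.
  apply/seteqP; split=> x /=; rewrite torus_frac_pi.
    move=> ax; exists (Num.floor x) => //=; rewrite in_itv /=.
    by have := floorD1_gt x; rewrite intrD => ->; rewrite andbT; lra.
  move=> [n _] /=; rewrite in_itv /= => /andP[nx xn].
  by rewrite (@floor_def _ x n) ?intrD; [lra|apply/andP; split; lra].
by apply: bigcup_open => n _; exact: interval_open.
Qed.

End FractionalPart.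

Section IntegerLabels.
Context {d : measure_display} {T : measurableType d} {R : realType}.

Lemma measurable_floor_label (I : finType) (h : T -> R) (c : int -> I) :
  measurable_fun setT h -> measurable_label (fun y => c (Num.floor (h y))).
Proof.
move=> mh i.
have -> : (fun y => c (Num.floor (h y))) @^-1` [set i] =
    \bigcup_z (if c z == i then h @^-1` `[z%:~R, z%:~R + 1[ else set0).
  apply/seteqP; split=> y /=.
    move=> ci; exists (Num.floor (h y)) => //=;
      rewrite ci eqxx /= in_itv /= floor_le /=.
    by have := floorD1_gt (h y); rewrite intrD.
  move=> [z _]; case: eqP => //= <-; rewrite in_itv /= => zh; congr c.
  by apply: floor_def; rewrite intrD.
apply: countable_bigcupT_measurable => [|z]; first exact: countableP;
  case: ifP => // _.
by rewrite -[X in measurable X]setTI; exact: mh.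
Qed.

Definition int_code B (z : int) : 'I_(B.*2.+1) := inord `|(z + B%:Z)%R|%N.

Lemma int_code_inj B (z z' : int) : (`|z| <= B)%N -> (`|z'| <= B)%N ->
  int_code B z = int_code B z' -> z = z'.
Proof.
move=> zB z'B /(congr1 val) /=; rewrite !inordK; lia.
Qed.

End IntegerLabels.

Section CarryLabel.
Context {R : realType}.
Variable f : {poly int}.

(** The integer by which the recurrence fails for the representatives in [0, 1)
    of the coordinates of a point of [X f]. *)
Definition carry (x : @X R f) : R :=
  poly_shift f (fun n => torus_frac ((val x : int -> torus R) n)) 0.

Definition carry_bound : nat := (\sum_(j < size f) `|(f`_j)%R|)%N.

Lemma carry_le x : `|carry x| <= carry_bound%:R.
Proof.
rewrite /carry /poly_shift /carry_bound (le_trans (ler_norm_sum _ _ _)) //.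
rewrite natr_sum; apply: ler_sum => j _.
rewrite -mulrzr normrM -intr_norm natr_absz ler_piMl ?ler0z //.
have /andP[t0 t1] := torus_frac_itv (zshift j%:Z (fun n =>
  (val x : int -> torus R) n) 0).
by rewrite ger0_norm // ltW.
Qed.

Definition carry_label (x : @X R f) : 'I_(carry_bound.*2.+1) :=
  int_code carry_bound (Num.floor (carry x)).

Lemma absz_floor_le (r : R) (B : nat) : `|r| <= B%:R -> (`|Num.floor r| <= B)%N.
Proof.
rewrite ler_norml => /andP[Br rB].
have h1 : - B%:Z <= Num.floor r by rewrite floor_ge_int // rmorphN.
have h2 : Num.floor r <= B%:Z.
  by rewrite -(ler_int R) (le_trans (floor_le _)).
by lia.
Qed.

Lemma measurable_carry_label :
  measurable_label (carry_label : borel (@X R f) -> _).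
Proof.
apply: measurable_floor_label.
rewrite /carry /poly_shift /zshift.
under eq_fun do under eq_bigr do rewrite -mulrzr.
apply: measurable_sum => j; apply: measurable_realfun.measurable_funM => //.
exact: (measurable_torus_frac (@X_coord_continuous R f (0 + j%:Z))).
Qed.

End CarryLabel.

(** * Rigidity of the fibres of xi_tilde *)

Section Rigidity.
Context {R : realType}.
Variables (beta : R) (f : {poly int}) (b : R[i] -> R[i]).
Hypothesis beta_gt1 : 1 < beta.
Hypothesis f_monic : f \is monic.
Hypothesis fb : partial_fractions f b.
Local Notation Y := (Ytilde_beta beta f).
Local Notation sigma := (sigma_tilde_beta b : Y -> Y).
Local Notation m := (size f).-1.

Definition lift_floor (y : Y) k : R := (Num.floor (lift b y k))%:~R.

Lemma xi_tilde_iter (y : Y) t :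
  xi_tilde b (iter t sigma y) = iter t (@alpha R f) (xi_tilde b y).
Proof. by elim: t => // t IHt; rewrite !iterS xi_tilde_sigma // IHt. Qed.

Lemma carry_xi_tilde (y : Y) t : carry (xi_tilde b (iter t sigma y)) =
  (val y).1 t%:Z - poly_shift f (lift_floor y) t%:Z.
Proof.
rewrite -[X in (val y).1 X]add0r -(digit_iter beta_gt1 f_monic fb)
  -(poly_shift_lift beta_gt1 f_monic fb).
rewrite -[X in poly_shift _ (lift_floor y) X]add0r -poly_shift_translate
  -poly_shiftB.
rewrite /carry val_xi_tilde //; apply: eq_bigr => j _.
by rewrite /zshift rhoE torus_frac_pi /lift_floor -(lift_iter beta_gt1 f_monic
  fb y t).
Qed.

Lemma xi_star_bound k : exists A : R, forall y :
  Y, `|xi_star f b (val y).1 k| <= A.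
Proof.
have [G [r [r0 r1 Gr]]] := xi_trunc_cvg b f_monic k.
exists (beta * G) => y.
have := (Gr _ _ (digit_le beta_gt1 y)).2 0%N.
by rewrite /xi_trunc /pairing !big_geq // addr0 subr0 expr0 mulr1.
Qed.

(** Digits are bounded, so in each step the fibre coordinate drifts by at most a
    constant. *)
Lemma lift_growth M : exists A : R, forall (y : Y) n,
  (forall j, (j < m)%N -> `|(val y).2 j%:Z| <= M) ->
  forall j, (j < m)%N -> `|lift b y (n + j)%N%:Z| <= A * n.+1%:R.
Proof.
have [C C0 CP] := W0_window_bound f_monic fb.
have [/bounded_funP[B0 wB0] _] := w_delta_zero_W0 f_monic fb.
pose Ax (j : int) := projT1 (cid (xi_star_bound j)).
have AxP j (y : Y) : `|xi_star f b (val y).1 j| <= Ax j.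
  exact: (projT2 (cid (xi_star_bound j)) y).
have Ax0 j : 0 <= Ax j := le_trans (normr_ge0 _) (AxP j point).
have B00 : 0 <= B0 := le_trans (normr_ge0 _) (wB0 0).
pose A1 := \sum_(j < m) Ax j%:Z.
exists (A1 + C * `|M| + beta * B0) => y n yM j jm.
have beta0 : 0 <= beta by rewrite ltW // (lt_trans ltr01).
have A10 : 0 <= A1 by apply: sumr_ge0.
have -> : lift b y (n + j)%N%:Z = lift b (iter n sigma y) j%:Z.
  by rewrite lift_iter //; congr (lift b y _); lia.
rewrite /lift (le_trans (ler_normD _ _)) // fibre_iter //.
have h1 : `|xi_star f b (val (iter n sigma y)).1 j%:Z| <= A1 * n.+1%:R.
  rewrite (le_trans (AxP _ _)) // (@le_trans _ _ A1) //.
    rewrite /A1 (bigD1 (Ordinal jm)) //= lerDl; exact: sumr_ge0.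
  by rewrite ler_peMr // ler1n.
have h2 : `|(val y).2 (j%:Z + n%:Z)| <= C * `|M| * n.+1%:R.
  have [_ Wy] := YtildeP y.
  rewrite (le_trans (CP _ _ Wy (fun j jm => le_trans (yM j jm) (ler_norm M)) _))
    //.
  by rewrite ler_peMr ?mulr_ge0 // ler1n.
have h3 : `|\sum_(i < n) (val y).1 i%:Z * w_delta_zero f b (j%:Z + n%:Z - i%:Z)|
  <=
    beta * B0 * n.+1%:R.
  rewrite (le_trans (ler_norm_sum _ _ _)) //.
  apply: (@le_trans _ _ (\sum_(i < n) beta * B0)).
    by apply: ler_sum => i _; rewrite normrM ler_pM // digit_le.
  by rewrite sumr_const card_ord -[leLHS]mulr_natr ler_wpM2l ?mulr_ge0 //
    ler_nat.
rewrite !mulrDl -addrA lerD // (le_trans (ler_normD _ _)) // lerD //.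
Qed.

Hypothesis f_beta : root (map_poly intr f) beta.

(** The carry word determines the digits from the integer parts of the lift at
    both ends of the window: the difference of two digit words with the same
    carries is [f(sigma)] of the difference of the integer parts. *)
Lemma carry_window_eq (y y' : Y) n :
  (forall t, (t < n)%N -> carry (xi_tilde b (iter t sigma y)) =
                          carry (xi_tilde b (iter t sigma y'))) ->
  (forall j, (j < m)%N -> lift_floor y j%:Z = lift_floor y' j%:Z) ->
  (forall j, (j < m)%N -> lift_floor y (n + j)%N%:Z = lift_floor y' (n +
    j)%N%:Z) ->
  forall t, (t < n)%N -> (val y).1 t%:Z = (val y').1 t%:Z.
Proof.
move=> cc l0 ln.
have [Vy _] := YtildeP y; have [Vy' _] := YtildeP y'.
apply: (V_beta_window_eq (y := fun k => lift_floor y k - lift_floor y' k)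
  beta_gt1 f_beta) => //.
- move=> i ni; rewrite poly_shiftB; have := cc i ni; rewrite !carry_xi_tilde;
  lra.
- by move=> j jm; rewrite l0 // subrr.
- by move=> j jm; rewrite ln // subrr.
Qed.

(** If moreover the digits near the window agree and the fibre coordinates are
    close at time [0], the orbits stay close during the whole window: equal
    digits translate the fibre coordinates by equal amounts, and translations of
    [W0 f] and the shift on it do not separate points by more than a constant
    factor. *)
Lemma carry_window_close : exists2 C : R, 0 < C & forall N n (y y' : Y),
  (forall t, (t < n)%N -> carry (xi_tilde b (iter t sigma y)) =
                          carry (xi_tilde b (iter t sigma y'))) ->
  (forall j, (j < m)%N -> lift_floor y j%:Z = lift_floor y' j%:Z) ->
  (forall j, (j < m)%N -> lift_floor y (n + j)%N%:Z = lift_floor y' (n +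
    j)%N%:Z) ->
  (forall i, (i < N)%N -> (val y).1 (- i.+1%:Z) = (val y').1 (- i.+1%:Z)) ->
  (forall i, (i < N)%N -> (val y).1 (n + i)%N%:Z = (val y').1 (n + i)%N%:Z) ->
  (forall j, (j < m)%N -> `|(val y).2 j%:Z - (val y').2 j%:Z| <= (C *
    N.+1%:R)^-1) ->
  forall t, (t < n)%N -> close N (iter t sigma y) (iter t sigma y').
Proof.
have [C0 C00 C0P] := W0_window_bound f_monic fb.
exists (C0 + 1) => [|N n y y' cc l0 ln past future fib t tn k kN];
  first by rewrite ltr_wpDl.
have mid := carry_window_eq cc l0 ln.
have digits l : - N%:Z <= l -> l < (n + N)%N%:Z -> (val y).1 l = (val y').1 l.
  move=> lN ln'; case: (lerP 0 l) => l0'.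
    case: (ltrP l n%:Z) => lnn.
      by rewrite (_ : l = `|l|%N%:Z); [apply: mid; lia|lia].
    rewrite (_ : l = (n + `|(l - n%:Z)%R|)%N%:Z); last lia.
    by apply: future; lia.
  rewrite (_ : l = - (`|l|.-1).+1%:Z); last lia.
  by apply: past; lia.
split; first by rewrite !digit_iter //; apply: digits; lia.
rewrite !fibre_iter // (_ : \sum_(i < t) (val y').1 i%:Z * _ =
    \sum_(i < t) (val y).1 i%:Z * w_delta_zero f b (k + t%:Z - i%:Z));
      last first.
  by apply: eq_bigr => i _; rewrite mid // (ltn_trans _ tn).
rewrite opprD addrACA subrr addr0.
pose w : zseq R := fun k => (val y).2 k - (val y').2 k.
have Ww : W0 f w.
  have [_ [/bounded_funP[B wB] fw]] := YtildeP y.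
  have [_ [/bounded_funP[B' wB'] fw']] := YtildeP y'.
  split; last by move=> l; rewrite poly_shiftB fw fw' subrr.
  apply/bounded_funP; exists (B + B') => l.
  by rewrite (le_trans (ler_normB _ _)) // lerD.
apply: le_lt_trans (C0P w _ Ww fib (k + t%:Z)) _.
have N0 : 0 < N.+1%:R :> R by [].
by rewrite invfM mulrA gtr_pMl ?invr_gt0 // ltr_pdivrMr ?ltr_wpDl //
  mul1r ltrDl.
Qed.

End Rigidity.

(** * Boundary labels *)

Section Growth.
Context {R : realType}.

(** This will be applied to the number of boundary labels of a window of length
    [n]. *)
Lemma ln_polynomial_growth (A E : nat) (eta : R) : 0 < eta ->
  exists n0, forall n,
  (n0 <= n)%N -> ln (((A * n.+1).*2.+1 ^ E).+1)%:R <= n%:R * eta.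
Proof.
move=> eta0; pose D : R := (A.*2.+1.*2)%:R; pose p := E.+1.
have D0 : 0 < D by rewrite ltr0n.
pose s : R := 2 * p%:R / eta.
have p0 : 0 < p%:R :> R by rewrite ltr0n.
have s0 : 0 < s by rewrite divr_gt0 // mulr_gt0.
have card_le n : (((A * n.+1).*2.+1 ^ E).+1 <= (A.*2.+1.*2 * n.+1) ^ p)%N.
  pose X := (A.*2.+1 * n.+1)%N.
  have X0 : (0 < X)%N by rewrite muln_gt0.
  have x1 : ((A * n.+1).*2.+1 <= X)%N by rewrite /X; nia.
  have -> : (A.*2.+1.*2 * n.+1 = 2 * X)%N by rewrite /X mulnA mul2n.
  have xE : ((A * n.+1).*2.+1 ^ E <= X ^ E)%N by case: (E) => // k;
    rewrite leq_exp2r.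
  have XE0 : (0 < X ^ E)%N by rewrite expn_gt0 X0.
  rewrite expnS (@leq_trans (2 * X ^ E)) //; first lia.
  rewrite leq_mul ?leq_pmulr //.
  by case: (E) => // k; rewrite leq_exp2r ?leq_pmull.
have ln_le n : ln n.+1%:R <= n.+1%:R / s + ln s :> R.
  have := @le_ln1Dx R (n.+1%:R / s - 1); rewrite [1 + _]addrC subrK.
  have ns : 0 < n.+1%:R / s by rewrite divr_gt0.
  have -> : -1 < n.+1%:R / s - 1 by lra.
  by move=> /(_ isT); rewrite ln_div ?posrE //; lra.
pose K := p%:R * (ln D + ln s) + eta / 2.
have [n0 n0K] : exists n0 : nat, K / (eta / 2) <= n0%:R.
  exists (Num.trunc (K / (eta / 2))).+1; exact/ltW/truncnS_gt.
exists n0 => n nn0.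
have nK : K <= n%:R * (eta / 2).
  rewrite -ler_pdivrMr ?divr_gt0 // (le_trans n0K) // ler_nat //.
apply: (@le_trans _ _ (ln ((D * n.+1%:R) ^+ p))).
  by rewrite ler_ln ?posrE ?ltr0n ?exprn_gt0 ?mulr_gt0 //
    /D -natrM -natrX ler_nat.
rewrite lnXn ?mulr_gt0 // lnM ?posrE // -[leLHS]mulr_natl.
have := ler_wpM2l (ltW p0) (ln_le n); rewrite mulrDr.
have -> : p%:R * (n.+1%:R / s) = n%:R * (eta / 2) + eta / 2.
  by rewrite /s -natr1; field; rewrite ?gt_eqF.
have -> : n%:R * eta = n%:R * (eta / 2) + n%:R * (eta / 2) by rewrite -mulrDr
  -splitr.
move: nK; rewrite /K !mulrDr.
move: (n%:R * (eta / 2)) (eta / 2) (p%:R * ln D) (p%:R * ln s) (p%:R * ln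
  n.+1%:R).
by move=> x1 x2 x3 x4 x5; lra.
Qed.

End Growth.

Section BoundaryLabel.
Context {R : realType}.
Variables (beta : R) (f : {poly int}) (b : R[i] -> R[i]).
Hypothesis beta_gt1 : 1 < beta.
Hypothesis f_monic : f \is monic.
Hypothesis fb : partial_fractions f b.
Local Notation Y := (Ytilde_beta beta f).
Local Notation BY := (borel Y).
Local Notation sigma := (sigma_tilde_beta b : Y -> Y).
Local Notation m := (size f).-1.
Variable mu : probability BY R.

Lemma continuous_measurable_real (T : ptopologicalType) (h : T -> R) :
  continuous h -> measurable_fun setT (h : borel T -> R).
Proof.
move=> /continuousP ch; apply: (measurability _
  (measurable_realfun.RGenOpens.measurableE R)) => _ [_ [a [c ->] <-]].
by rewrite setTI; apply: open_borel; apply: ch; exact: interval_open.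
Qed.

Definition fibre_ball (M : R) (y : Y) : bool :=
  [forall j : 'I_m, `|(val y).2 j%:Z| <= M].

Lemma measurable_fibre_ball M : measurable_label (fibre_ball M : BY -> bool).
Proof.
pose g (j : 'I_m) (y : BY) := `|(val y).2 j%:Z| <= M.
have mg j : measurable_label (g j).
  have mw : measurable_fun setT (fun y : BY => `|(val y).2 j%:Z|).
    apply: measurableT_comp => //; apply: continuous_measurable_real.
    exact: fibre_continuous.
  have := measurable_realfun.measurable_fun_ler mw (measurable_cst M).
  by move=> mle i; rewrite -[X in measurable X]setTI; exact: mle.
have -> : fibre_ball M = (fun s : {ffun 'I_m -> bool} => [forall j, s j]) \o
    (fun y => [ffun j => g j y]).
  by apply/funext => y; apply: eq_forallb => j; rewrite ffunE.
exact: measurable_label_comp (measurable_label_ffun mg).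
Qed.

Lemma fibre_ball_large (e : R) : 0 < e ->
  exists M, (mu (~` [set y | fibre_ball M y]) <= e%:E)%E.
Proof.
move=> e0; have := @vanishing_measure _ _ _ mu (fun n =>
  ~` [set y | fibre_ball n%:R y]) e e0.
case=> [n|n k nk y||n ?]; last by exists n%:R.
- apply: measurableC; have := @measurable_fibre_ball n%:R true.
  by congr measurable; apply/seteqP; split=> y.
- move=> nky ny; apply: nky; apply/forallP => j.
  by rewrite (le_trans (forallP ny j)) // ler_nat.
- apply/seteqP; split=> // y yall.
  pose S := \sum_(j < m) `|(val y).2 j%:Z|.
  have [] := yall (Num.trunc S).+1 I; apply/forallP => j.
  apply: ltW; apply: le_lt_trans (truncnS_gt _).
  by rewrite /S (bigD1 j) //= lerDl sumr_ge0.
Qed.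

Lemma digit_floorE (y : Y) k : (val y).1 k = (Num.floor ((val y).1 k))%:~R.
Proof. by have /intrP[z ->] := digit_int y k; rewrite intrKfloor. Qed.

Lemma carry_xi_tilde_int (y : Y) : carry (xi_tilde b y) \is a Num.int.
Proof.
rewrite (carry_xi_tilde beta_gt1 f_monic fb y 0) rpredB ?digit_int //.
apply: rpred_sum => j _; rewrite -mulrzr rpredM ?intr_int //.
Qed.

Lemma carry_label_eq (y y' : Y) :
  carry_label (xi_tilde b y) = carry_label (xi_tilde b y') ->
  carry (xi_tilde b y) = carry (xi_tilde b y').
Proof.
have carry_code x := absz_floor_le (@carry_le R f x).
move=> /(int_code_inj (carry_code _) (carry_code _)).
have /intrP[z zE] := carry_xi_tilde_int y; have /intrP[z' z'E] :=
  carry_xi_tilde_int y'.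
by rewrite zE z'E !intrKfloor => ->.
Qed.

(** Boundary data of the window [0, n): digits near both ends, integer parts of
    the lift at both ends and the fibre coordinates, which are rescaled so that
    equal integer parts mean closeness. *)
Definition boundary_index N : finType :=
  ('I_N + 'I_N + 'I_m + 'I_m + 'I_m)%type.

Definition boundary_data N (K : R) n (e : boundary_index N) (y : Y) : R :=
  match e with
  | inl (inl (inl (inl i))) => (val y).1 (- i.+1%:Z)
  | inl (inl (inl (inr i))) => (val y).1 (n + i)%N%:Z
  | inl (inl (inr j)) => lift b y j%:Z
  | inl (inr j) => lift b y (n + j)%N%:Z
  | inr j => (val y).2 j%:Z * K
  end.

(** The fibre is not compact; outside a large ball the data are unbounded and
    are not recorded. *)
Definition boundary_label N K n B M (y : Y) :
    option {ffun boundary_index N -> 'I_(B.*2.+1)} :=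
  if fibre_ball M y then
    Some [ffun e => int_code B (Num.floor (boundary_data K n e y))]
  else None.

Lemma measurable_boundary_label N K n B M :
  measurable_label (@boundary_label N K n B M : BY -> _).
Proof.
pose g (e : boundary_index N) (y : BY) :=
  int_code B (Num.floor (boundary_data K n e y)).
have mg e : measurable_label (g e).
  apply: measurable_floor_label; apply: continuous_measurable_real => y.
  case: e => [[[[i|i]|j]|j]|j] /=; try exact: digit_continuous;
    try exact: lift_continuous.
  have FF : Filter (nbhs y) := nbhs_filter y.
  rewrite /continuous_at /=; apply: (@cvgMl R _ _ FF); exact: fibre_continuous.
have -> : @boundary_label N K n B M =
   (fun bs : bool * {ffun boundary_index N -> 'I_(B.*2.+1)} =>
     if bs.1 then Some bs.2 else None) \o
   (fun y => (fibre_ball M y, [ffun e => g e y])) by [].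
apply: measurable_label_comp; apply: measurable_label_pair.
  exact: measurable_fibre_ball.
exact: measurable_label_ffun.
Qed.

Lemma boundary_data_growth N K M : exists A : nat, forall n y, fibre_ball M y ->
  forall e, `|@boundary_data N K n e y| <= (A * n.+1)%:R.
Proof.
have [A1 A1P] := lift_growth beta_gt1 f_monic fb M.
pose A0 := `|A1| + beta + `|M| * `|K|.
have beta0 : 0 <= beta by rewrite ltW // (lt_trans ltr01).
have [A AA] : exists A : nat, A0 <= A%:R.
  exists (Num.trunc A0).+1; exact/ltW/truncnS_gt.
exists A => n y /forallP yM e.
have n1 : 1 <= n.+1%:R :> R by rewrite ler1n.
have step (x : R) : x <= A0 -> x <= (A * n.+1)%:R.
  move=> xA; rewrite natrM (le_trans xA) // (le_trans AA) // ler_peMr //.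
have h0 := normr_ge0 A1; have h1 := mulr_ge0 (normr_ge0 M) (normr_ge0 K).
have liftle k j : (j < m)%N -> `|lift b y (k + j)%N%:Z| <= `|A1| * k.+1%:R.
  move=> jm; rewrite (le_trans (A1P y k (fun j jm => yM (Ordinal jm)) j jm)) //.
  by rewrite ler_wpM2r // ler_norm.
case: e => [[[[i|i]|j]|j]|j] /=.
- by apply: step; rewrite (le_trans (digit_le beta_gt1 _ _)) // /A0; lra.
- by apply: step; rewrite (le_trans (digit_le beta_gt1 _ _)) // /A0; lra.
- apply: step; have := liftle 0%N j (ltn_ord j);
  rewrite add0n mulr1 => /le_trans; apply.
  by rewrite /A0; lra.
- rewrite (le_trans (liftle n j (ltn_ord j))) // natrM ler_wpM2r //.
  by rewrite (le_trans _ AA) // /A0; lra.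
- apply: step; rewrite normrM (@le_trans _ _ (`|M| * `|K|)) //;
  last by rewrite /A0; lra.
  by rewrite ler_wpM2r // (le_trans (yM j)) // ler_norm.
Qed.

End BoundaryLabel.

(** * Comparison of the entropies *)

Section EntropyComparison.
Context {R : realType}.
Variables (beta : R) (f : {poly int}) (b : R[i] -> R[i]).
Hypothesis beta_gt1 : 1 < beta.
Hypothesis f_monic : f \is monic.
Hypothesis f_beta : root (map_poly intr f) beta.
Hypothesis fb : partial_fractions f b.
Local Notation Y := (Ytilde_beta beta f).
Local Notation BY := (borel Y).
Local Notation sigma := (sigma_tilde_beta b : BY -> BY).
Local Notation m := (size f).-1.
Variable mu : probability BY R.
Hypothesis mu_sigma : invariant_measure mu (sigma : BY -> BY).

Definition carry_of (y : Y) := carry_label (xi_tilde b y).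

Lemma measurable_sigma_tilde : measurable_fun setT (sigma : BY -> BY).
Proof. by apply: continuous_borel; exact: sigma_tilde_continuous. Qed.

Lemma measurable_xi_tilde : measurable_fun setT (xi_tilde b : BY ->
  borel (@X R f)).
Proof. by apply: continuous_borel; exact: xi_tilde_continuous. Qed.

Lemma measurable_label_xi_tilde (I : finType) (g : borel (@X R f) -> I) :
  measurable_label g -> measurable_label (g \o xi_tilde b : BY -> I).
Proof.
move=> mg i; rewrite comp_preimage -[X in measurable X]setTI.
exact: measurable_xi_tilde.
Qed.

Lemma predictability N M : exists (K : R) (A : nat), forall n (y y' : Y),
  fibre_ball M y ->
  itinerary sigma carry_of n y = itinerary sigma carry_of n y' ->
  boundary_label b N K n (A * n.+1) M y =
    boundary_label b N K n (A * n.+1) M y' ->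
  fibre_ball M y' /\
  forall t, (t < n)%N -> close N (iter t sigma y) (iter t sigma y').
Proof.
have [C C0 Cclose] := carry_window_close beta_gt1 f_monic fb f_beta.
pose K := C * N.+1%:R; have K0 : 0 < K by rewrite mulr_gt0.
have [A Agrowth] := boundary_data_growth beta_gt1 f_monic fb N K M.
exists K, A => n y y' yM /ffunP Cyy'; rewrite /boundary_label yM.
case: ifP => // y'M [] /ffunP data; split=> //.
have floor_eq (e : boundary_index f N) :
    Num.floor (boundary_data b K n e y) = Num.floor (boundary_data b K n e y').
  by have := data e; rewrite !ffunE => /int_code_inj; apply;
    apply: absz_floor_le; exact: Agrowth.
apply: Cclose.
- move=> t tn; apply: (carry_label_eq beta_gt1 f_monic fb).
  by have := Cyy' (Ordinal tn); rewrite !ffunE => h; exact: h.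
- move=> j jm; congr _%:~R; exact: (floor_eq (inl (inl (inr (Ordinal jm))))).
- move=> j jm; congr _%:~R; exact: (floor_eq (inl (inr (Ordinal jm)))).
- move=> i iN; rewrite digit_floorE [RHS]digit_floorE; congr _%:~R.
  exact: (floor_eq (inl (inl (inl (inl (Ordinal iN)))))).
- move=> i iN; rewrite digit_floorE [RHS]digit_floorE; congr _%:~R.
  exact: (floor_eq (inl (inl (inl (inr (Ordinal iN)))))).
- move=> j jm; rewrite -[(C * _)^-1]/(K^-1) -[K^-1]mul1r ler_pdivlMr //.
  rewrite -{1}(gtr0_norm K0) -normrM mulrBl.
  have /= fe := floor_eq (inr (Ordinal jm)).
  have l1 := floor_le ((val y).2 j%:Z * K); have l2 := floor_le ((val y').2 j%:Z
    * K).
  have u1 := floorD1_gt ((val y).2 j%:Z * K); have u2 := floorD1_gt ((val y').2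
    j%:Z * K).
  move: l1 l2 u1 u2; rewrite fe intrD ler_norml.
  by move=> l1 l2 u1 u2; apply/andP; split; lra.
Qed.

(** The fibres of [xi_tilde] carry no entropy: over the carry word, which is a
    function of the image in [X f], the itinerary of any finite valued function
    is predicted by polynomially many boundary labels, up to the times at which
    the orbit leaves the set where the function is locally constant. *)
Lemma entropy_over_carry (I : finType) (Q : BY -> I) (eta : R) :
  measurable_label Q -> 0 < eta -> exists n0, forall n, (n0 <= n)%N ->
  label_entropy mu (itinerary sigma Q n) <=
  label_entropy mu (itinerary sigma carry_of n) + n%:R * eta.
Proof.
move=> mQ eta0.
have msigma := measurable_sigma_tilde.
pose delta : R := 1 - expR (- (eta / 4)).
have eta4 : 0 < eta / 4 by rewrite divr_gt0.
have delta0 : 0 < delta by rewrite subr_gt0 expR_lt1 oppr_lt0.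
have delta1 : delta < 1 by rewrite /delta ltrBlDl ltrDr expR_gt0.
(* [delta] is chosen so that correct predictions cost [eta / 4] each *)
have cost_hit : - ln (1 - delta) = eta / 4.
  by rewrite /delta opprB addrC subrK expRK opprK.
pose cost := - ln (delta / #|I|%:R).
(* an error has probability at most [e + e] and costs at most [cost] *)
pose e := eta / 8 / (1 + `|cost|).
have c1 : 0 < 1 + `|cost| by rewrite ltr_wpDr.
have e0 : 0 < e by rewrite !divr_gt0.
have [N [S [mS muS SQ]]] := lusin_label mu mQ e0.
have [M muM] := fibre_ball_large mu e0.
have [K [A pred_close]] := predictability N M.
pose L n := boundary_label b N K n (A * n.+1) M : BY -> _.
(* the symbol at time [t] of a point with these labels that is then in [S] *)
pose predicted n c (l : option {ffun boundary_index f N ->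
  'I_((A * n.+1).*2.+1)}) (t : 'I_n) :=
  Q (iter t sigma (xget point [set y : Y |
     [/\ itinerary sigma carry_of n y = c, L n y = l & S (iter t sigma y)]])).
pose cardE := #|boundary_index f N|.
have [n0 growth] := @ln_polynomial_growth R A cardE (eta / 2) ltac:(by rewrite
  divr_gt0).
exists n0 => n n0n.
have mC : measurable_label (itinerary sigma carry_of n : BY -> _).
  apply: measurable_itinerary => //.
  exact: (measurable_label_xi_tilde (@measurable_carry_label R f)).
have mL : measurable_label (L n) by exact: measurable_boundary_label.
apply: le_trans (coding_bound mu msigma (predicted n) mQ mC mL delta0 delta1) _.
rewrite -addrA lerD2l.
have -> : n%:R * eta = n%:R * (eta / 2) + n%:R * (eta / 2) by rewrite -mulrDr
  -splitr.
apply: lerD.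
  by rewrite card_option card_ffun card_ord growth.
have -> : n%:R * (eta / 2) = \sum_(t < n) eta / 2.
  by rewrite sumr_const card_ord mulr_natl.
apply: ler_sum => t _.
rewrite cost_hit -/cost (_ : eta / 2 = eta / 4 + eta / 4); last by field.
rewrite lerD2l.
set miss := [set y | _].
have mSk k : measurable (iter k sigma @^-1` S : set BY).
  have mit : measurable_fun setT (iter k sigma : BY -> BY).
    elim: k => [|k IHk]; first exact: measurable_id.
    exact: measurableT_comp.
  by rewrite -[X in measurable X]setTI; exact: mit.
have muSk k : mu (~` (iter k sigma @^-1` S)) = mu (~` S).
  elim: k => // k <-; rewrite -[RHS]mu_sigma; last exact: measurableC.
  by rewrite /pushforward; congr (mu _); apply/seteqP; split=> y /=;
    rewrite -iterS iterSr.
have mball : measurable ([set y | fibre_ball M y] : set BY).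
  have := @measurable_fibre_ball _ beta f M true.
  by congr measurable; apply/seteqP; split=> y.
have miss_sub : miss `<=` ~` ([set y : Y | fibre_ball M y] `&` iter t sigma
  @^-1` S).
  move=> y /= /eqP missy [yM yS]; apply: missy; rewrite /predicted.
  case: xgetP => [z _ [Cz Lz Sz]|/(_ y)]; last by case.
  have [_ yz] := pred_close n y z yM (esym Cz) (esym Lz).
  exact: SQ yS Sz (yz t (ltn_ord t)).
have mmiss : measurable miss.
  have mQt : measurable_label (Q \o iter t sigma : BY -> I).
    exact: measurable_label_iter.
  have := measurable_label_pair mQt (measurable_label_pair mC mL).
  move=> /(measurable_label_set [set j | j.1 != predicted n j.2.1 j.2.2 t]).
  exact.
have muSt : (mu (~` (iter t sigma @^-1` S)) <= e%:E)%E by rewrite muSk.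
have mu_miss : fine (mu miss) <= e + e.
  rewrite -lee_fin fineK ?fin_num_measure //.
  apply: le_trans (measure_setCI mball (mSk t) muM muSt).
  by apply: le_measure => //; rewrite inE //; apply: measurableC;
    exact: measurableI.
apply: (@le_trans _ _ ((e + e) * `|cost|)).
  apply: (@le_trans _ _ (fine (mu miss) * `|cost|)).
    by rewrite ler_wpM2l ?fine_ge0 // ler_norm.
  by rewrite ler_wpM2r.
apply: (@le_trans _ _ ((e + e) * (1 + `|cost|))).
  by rewrite ler_wpM2l ?lerDr // addr_ge0 // ltW.
rewrite mulrDl /e divfK ?gt_eqF //; lra.
Qed.

End EntropyComparison.

Theorem theorem1p2 (R : realType) (beta : R) (f : {poly int})
    (b : R[i] -> R[i]) (mu : probability (borel (Ytilde_beta beta f)) R) :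
  salem_number beta f ->
  partial_fractions f b ->
  invariant_measure mu (sigma_tilde_beta b) ->
  entropy (pushforward mu (xi_tilde b : _ -> borel (X f))) (alpha (f:=f)) =
  entropy mu (sigma_tilde_beta b).
Proof.
move=> [_ beta_gt1 [f_monic f_beta _] _ _] fb inv.
have msigma := measurable_sigma_tilde beta_gt1 f_monic fb.
have mxi := @measurable_label_xi_tilde _ _ _ _ beta_gt1 f_monic fb.
set nu := pushforward mu _.
pose T : borel (X f) -> borel (X f) := @alpha R f.
pose S : borel (Ytilde_beta beta f) -> borel (Ytilde_beta beta f) :=
  sigma_tilde_beta b.
have transfer (I : finType) (g : borel (X f) -> I) n :
    label_entropy nu (itinerary T g n) =
    label_entropy mu (itinerary S (g \o xi_tilde b) n).
  have it y : itinerary T g n (xi_tilde b y) = itinerary S (g \o xi_tilde b) n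
    y.
    by apply/ffunP => t; rewrite !ffunE /= xi_tilde_iter.
  apply: eq_bigr => s _; rewrite /label_prob /nu /pushforward.
  suff -> : xi_tilde b @^-1` (itinerary T g n @^-1` [set s]) =
    itinerary S (g \o xi_tilde b) n @^-1` [set s] by [].
  by apply/seteqP; split=> y /=; rewrite it.
rewrite -/T -/S.
apply/le_anti/andP; split; apply: ub_ereal_sup => _ [k [P [mP ->]]].
  have [g mg ->] := partition_label mP.
  have [k' [g' [mg' mP' gg']]] := label_partition (mxi _ g mg).
  apply: ereal_sup_ubound; exists k', (fun i => g' @^-1` [set i]); split=> //.
  congr (limn _)%:E; apply/funext => n.
  by rewrite !join_entropy_label transfer (label_entropy_itinerary mu n msigma
    (mxi _ g mg) mg' gg').
have [Q mQ ->] := partition_label mP.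
(* the partition of [X f] according to the carry has at least the entropy of P
   *)
have [k' [C [mC mP' CE]]] := label_partition (@measurable_carry_label R f).
apply: (@le_trans _ _ (partition_entropy nu T (fun i => C @^-1` [set i]))%:E).
  have mcarry := mxi _ _ (@measurable_carry_label R f).
  (* it suffices to compare up to [eta] for large [n], as both limits exist *)
  rewrite lee_fin /partition_entropy.
  under eq_fun do rewrite join_entropy_label.
  under [X in _ <= limn X]eq_fun do rewrite join_entropy_label transfer
    (label_entropy_itinerary mu _ msigma mcarry (mxi _ _ mC) (fun y y' =>
      CE _ _)).
  have cQ := cvg_entropy_rate msigma inv mQ.
  pose u n := label_entropy mu (itinerary S (carry_label (f:=f) \o xi_tilde b)
    n) / n%:R.
  have cC : cvgn u := cvg_entropy_rate msigma inv mcarry.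
  apply/ler_addgt0Pr => eta eta0.
  have [n0 Qn] := entropy_over_carry beta_gt1 f_monic f_beta fb inv mQ eta0.
  have cCeta : u n + eta @[n --> \oo] --> limn u + eta.
    by apply: cvgD => //; exact: cvg_cst.
  rewrite -[leRHS]/(limn u + eta) -(cvg_lim _ cCeta) //; apply: ler_lim => //.
    by apply/cvg_ex; eexists; exact: cCeta.
  exists n0.+1 => // n /= n0n.
  have nR : 0 < n%:R :> R by rewrite ltr0n (leq_trans _ n0n).
  rewrite ler_pdivrMr // mulrDl divfK ?gt_eqF // [eta * _]mulrC.
  by rewrite Qn // ltnW.
by apply: ereal_sup_ubound; exists k', (fun i => C @^-1` [set i]).
Qed.
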